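(* Let $\Gamma\vdash t:A$ be derivable in the IMELL typing system below and let $t\to_{\mathrm{ms}} s$. Then $\Gamma\vdash s:A$ is derivable.
   Context: Exponential substitution calculus (ESC). Variables: multiplicative $m,n,o,\ldots$ and exponential $e,f,g,\ldots$ (disjoint kinds); $x,y,z$ range over both. Multiplicative values $v_{\mathsf m} ::= m \mid (t,s) \mid \lambda x.t$; exponential values $v_{\mathsf e} ::= e \mid\ !t$; values $v ::= v_{\mathsf m}\mid v_{\mathsf e}$. Terms: $t,s,u ::= v \mid \mathsf{cut}(v,x.t) \mid \mathsf{par}(m,x.y.t) \mid \mathsf{sub}(m,v,x.t) \mid \mathsf{der}(e,x.t)$; in $\lambda x.t$, cut, sub, der the variable $x$ is bound in $t$, in par $x,y$ are bound; terms up to $\alpha$; $\mathrm{fv}$ = free variables. Left contexts $L ::= \langle\cdot\rangle \mid \mathsf{cut}(v,x.L)\mid\mathsf{par}(m,x.y.L)\mid\mathsf{sub}(m,v,x.L)\mid\mathsf{der}(e,x.L)$; every term is uniquely $L\langle v\rangle$. Value contexts $V ::= \langle\cdot\rangle \mid (C,s)\mid (t,C)\mid\lambda x.C\mid\ !C$; general contexts $C ::= V \mid \mathsf{cut}(V,x.t)\mid\mathsf{sub}(m,V,x.t)\mid L\langle C\rangle$; multiplicative value contexts $V_{\mathsf m} ::= \langle\cdot\rangle\mid (M,s)\mid(t,M)\mid\lambda x.M$; multiplicative contexts $M ::= V_{\mathsf m}\mid \mathsf{cut}(V_{\mathsf m},x.t)\mid \mathsf{sub}(m,V_{\mathsf m},x.t)\mid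 L\langle M\rangle$. Plugging $C\langle t\rangle$ replaces the hole (may capture), except that if $t=L\langle v\rangle$ then $\mathsf{cut}(\langle\cdot\rangle,x.s)\langle t\rangle := L\langle\mathsf{cut}(v,x.s)\rangle$ and $\mathsf{sub}(m,\langle\cdot\rangle,x.s)\langle t\rangle := L\langle\mathsf{sub}(m,v,x.s)\rangle$; $C\langle\!\langle t\rangle\!\rangle$ is capture-avoiding plugging. For multiplicative $m,n$, $\{n/m\}t$ is renaming. Root rules (context does not capture the cut variable): (ax$_{m1}$) $\mathsf{cut}(v_{\mathsf m},m.M\langle\!\langle m\rangle\!\rangle)\mapsto M\langle\!\langle v_{\mathsf m}\rangle\!\rangle$; (ax$_{m2}$) $\mathsf{cut}(n,m.t)\mapsto \{n/m\}t$; ($\otimes$) $\mathsf{cut}((s,u),m.M\langle\mathsf{par}(m,x.y.t)\rangle)\mapsto M\langle L\langle\mathsf{cut}(v,x.L'\langle\mathsf{cut}(v',y.t)\rangle)\rangle\rangle$ where $s=L\langle v\rangle$, $u=L'\langle v'\rangle$; ($\multimap$) $\mathsf{cut}(\lambda y.s,m.M\langle\mathsf{sub}(m,v,x.t)\rangle)\mapsto M\langle\mathsf{cut}(v,y.L\langle\mathsf{cut}(v',x.t)\rangle)\rangle$ where $s=L\langle v'\rangle$; (ax$_{e1}$) $\mathsf{cut}(v_{\mathsf e},e.C\langle\!\langle e\rangle\!\rangle)\mapsto\mathsf{cut}(v_{\mathsf e},e.C\langle\!\langle v_{\mathsf e}\rangle\!\rangle)$; (ax$_{e2}$) $\mathsf{cut}(f,e.C\langle\mathsf{der}(e,x.t)\rangle)\mapsto\mathsf{cut}(f,e.C\langle\mathsf{der}(f,x.t)\rangle)$;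 (!der) $\mathsf{cut}(!s,e.C\langle\mathsf{der}(e,x.t)\rangle)\mapsto\mathsf{cut}(!s,e.C\langle L\langle\mathsf{cut}(v,x.t)\rangle\rangle)$ where $s=L\langle v\rangle$; (w) $\mathsf{cut}(v_{\mathsf e},e.t)\mapsto t$ if $e\notin\mathrm{fv}(t)$. $\to_{\mathrm{ms}}$ is the union of the closures of these rules under general contexts. Typing. Formulas $A,B ::= X \mid A\otimes B\mid A\multimap B\mid\ !A$ ($X$ atomic). Typing contexts $\Gamma$ are finite assignments of formulas to variables; $\Gamma\#\Delta$ means disjoint domains; $!\Gamma$ means all formulas in $\Gamma$ are of the form $!B$. Rules: $m:A\vdash m:A$ if $A$ is not of the form $!B$; $e:!A\vdash e:!A$; from $\Gamma\vdash t:A$, $\Delta\vdash s:B$, $\Gamma\#\Delta$ infer $\Gamma,\Delta\vdash(t,s):A\otimes B$; from $x:A,\Gamma\vdash t:B$ infer $\Gamma\vdash\lambda x.t:A\multimap B$; (cut) from $\Gamma\vdash L\langle v\rangle:A$, $\Delta,x:A\vdash t:B$, $\Gamma\#(\Delta,x:A)$ infer $\Gamma,\Delta\vdash L\langle\mathsf{cut}(v,x.t)\rangle:B$; from $\Gamma,x:A,y:B\vdash t:C$, $m$ fresh, infer $\Gamma,m:A\otimes B\vdash\mathsf{par}(m,x.y.t):C$; from $\Gamma\vdash L\langle v\rangle:A$, $\Delta,x:B\vdash t:C$, $\Gamma\#(\Delta,x:B)$, $m$ fresh, infer $\Gamma,\Delta,m:A\multimap B\vdash L\langle\mathsf{sub}(m,v,x.t)\rangle:C$;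 from $\Gamma,x:A\vdash t:B$, $e$ fresh, infer $\Gamma,e:!A\vdash\mathsf{der}(e,x.t):B$; from $!\Gamma\vdash t:A$ infer $!\Gamma\vdash\ !t:!A$; (weakening) from $\Gamma\vdash t:A$, $e$ fresh, infer $\Gamma,e:!B\vdash t:A$; (contraction) from $\Gamma,e:!B,f:!B\vdash t:A$ infer $\Gamma,e:!B\vdash\{e/f\}t:A$, where $\{e/f\}t$ renames free $f$ into $e$. *)

(* Defs.v *)
From HB Require Import structures.
From mathcomp Require Import all_boot.
From mathcomp Require Export finmap.

Set Implicit Arguments.
Unset Strict Implicit.
Unset Printing Implicit Defensive.

Local Open Scope fset_scope.
Local Open Scope fmap_scope.

(** * Variables *)

Inductive kind := Mul | Exp.

Definition bool_of_kind k := if k is Mul then true else false.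
Definition kind_of_bool b := if b then Mul else Exp.
Lemma bool_of_kindK : cancel bool_of_kind kind_of_bool.
Proof. by case. Qed.
HB.instance Definition _ := Countable.copy kind (can_type bool_of_kindK).

(* [(Mul, n)] and [(Exp, n)] are different variables: the multiplicative and
   the exponential variables are disjoint. *)
Definition var : Type := (kind * nat)%type.
HB.instance Definition _ := Countable.copy var (kind * nat)%type.

(** * Terms

    Raw terms with named binders; alpha-equivalence is the relation [alpha]
    below, under which both typing and reduction are closed.  Where the syntax
    requires a variable of a given kind, only its name (a [nat]) is stored; a
    binder may be of either kind, so it stores a [var].  In [tPar m x y t] the
    scope of [x] is [y.t], so [y] shadows [x] in case they coincide. *)

Inductive term :=
| tVal of value
| tCut of value & var & term
| tPar of nat & var & var & term
| tSub of nat & value & var & term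
| tDer of nat & var & term
with value :=
| vMul of nat
| vExp of nat
| vPair of term & term
| vLam of var & term
| vBang of term.

Definition mult_value v :=
  match v with vMul _ | vPair _ _ | vLam _ _ => true | vExp _ | vBang _ => false end.
Definition exp_value v := ~~ mult_value v.

Fixpoint fv t : {fset var} :=
  match t with
  | tVal v => fvv v
  | tCut v x t => fvv v `|` (fv t `\ x)
  | tPar m x y t => ((Mul, m) : var) |` (fv t `\ y `\ x)
  | tSub m v x t => ((Mul, m) : var) |` (fvv v `|` (fv t `\ x))
  | tDer e x t => ((Exp, e) : var) |` (fv t `\ x)
  end
with fvv v : {fset var} :=
  match v with
  | vMul m => [fset ((Mul, m) : var)]
  | vExp e => [fset ((Exp, e) : var)]
  | vPair t s => fv t `|` fv s
  | vLam x t => fv t `\ x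
  | vBang t => fv t
  end.

(* All the variables bound somewhere in a term. *)
Fixpoint bv t : {fset var} :=
  match t with
  | tVal v => bvv v
  | tCut v x t => bvv v `|` (x |` bv t)
  | tPar _ x y t => x |` (y |` bv t)
  | tSub _ v x t => bvv v `|` (x |` bv t)
  | tDer _ x t => x |` bv t
  end
with bvv v : {fset var} :=
  match v with
  | vMul _ | vExp _ => fset0
  | vPair t s => bv t `|` bv s
  | vLam x t => x |` bv t
  | vBang t => bv t
  end.

(* [ren k j i t] replaces the free occurrences of the variable [i] of kind [k]
   by [j] (of the same kind), without renaming binders: it is the
   capture-avoiding {j/i}t as soon as [(k, j)] is not in [bv t]. *)
Section Renaming.
Variables (k : kind) (j i : nat).

Definition renn (k' : kind) (m : nat) : nat :=
  if (k' == k) && (m == i) then j else m.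

Fixpoint ren t : term :=
  match t with
  | tVal v => tVal (renv v)
  | tCut v x t => tCut (renv v) x (if x == (k, i) then t else ren t)
  | tPar m x y t =>
      tPar (renn Mul m) x y (if (x == (k, i)) || (y == (k, i)) then t else ren t)
  | tSub m v x t =>
      tSub (renn Mul m) (renv v) x (if x == (k, i) then t else ren t)
  | tDer e x t => tDer (renn Exp e) x (if x == (k, i) then t else ren t)
  end
with renv v : value :=
  match v with
  | vMul m => vMul (renn Mul m)
  | vExp e => vExp (renn Exp e)
  | vPair t s => vPair (ren t) (ren s)
  | vLam x t => vLam x (if x == (k, i) then t else ren t)
  | vBang t => vBang (ren t)
  end.
End Renaming.

Definition unused (x : var) (t : term) : bool := x \notin fv t `|` bv t.

(* The least congruence that allows to rename a binder to an unused variable of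
   the same kind. *)
Inductive alpha : term -> term -> Prop :=
| al_refl t : alpha t t
| al_sym t s : alpha t s -> alpha s t
| al_trans t s u : alpha t s -> alpha s u -> alpha t u
| al_val v v' : alphav v v' -> alpha (tVal v) (tVal v')
| al_cut v v' x t t' :
    alphav v v' -> alpha t t' -> alpha (tCut v x t) (tCut v' x t')
| al_par m x y t t' : alpha t t' -> alpha (tPar m x y t) (tPar m x y t')
| al_sub m v v' x t t' :
    alphav v v' -> alpha t t' -> alpha (tSub m v x t) (tSub m v' x t')
| al_der e x t t' : alpha t t' -> alpha (tDer e x t) (tDer e x t')
| al_cut_ren v k i j t : unused (k, j) t ->
    alpha (tCut v (k, i) t) (tCut v (k, j) (ren k j i t))
| al_par_ren1 m k i j y t : unused (k, j) t -> (k, j) != y ->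
    alpha (tPar m (k, i) y t)
          (tPar m (k, j) y (if (k, i) == y then t else ren k j i t))
| al_par_ren2 m x k i j t : unused (k, j) t -> (k, j) != x ->
    alpha (tPar m x (k, i) t) (tPar m x (k, j) (ren k j i t))
| al_sub_ren m v k i j t : unused (k, j) t ->
    alpha (tSub m v (k, i) t) (tSub m v (k, j) (ren k j i t))
| al_der_ren e k i j t : unused (k, j) t ->
    alpha (tDer e (k, i) t) (tDer e (k, j) (ren k j i t))
with alphav : value -> value -> Prop :=
| alv_refl v : alphav v v
| alv_sym v w : alphav v w -> alphav w v
| alv_trans v w u : alphav v w -> alphav w u -> alphav v u
| alv_pair t t' s s' : alpha t t' -> alpha s s' -> alphav (vPair t s) (vPair t' s')
| alv_lam x t t' : alpha t t' -> alphav (vLam x t) (vLam x t')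
| alv_bang t t' : alpha t t' -> alphav (vBang t) (vBang t')
| alv_lam_ren k i j t : unused (k, j) t ->
    alphav (vLam (k, i) t) (vLam (k, j) (ren k j i t)).

(** * Left contexts *)

Inductive lctx :=
| lHole
| lCut of value & var & lctx
| lPar of nat & var & var & lctx
| lSub of nat & value & var & lctx
| lDer of nat & var & lctx.

Fixpoint lplug L t : term :=
  match L with
  | lHole => t
  | lCut v x L => tCut v x (lplug L t)
  | lPar m x y L => tPar m x y (lplug L t)
  | lSub m v x L => tSub m v x (lplug L t)
  | lDer e x L => tDer e x (lplug L t)
  end.

(* The variables bound by a left context, all of which scope over its hole. *)
Fixpoint lcapt L : {fset var} :=
  match L with
  | lHole => fset0
  | lCut _ x L | lSub _ _ x L | lDer _ x L => x |` lcapt L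
  | lPar _ x y L => x |` (y |` lcapt L)
  end.

(* The unique decomposition of a term as L<v>. *)
Fixpoint split t : lctx * value :=
  match t with
  | tVal v => (lHole, v)
  | tCut v x t => let: (L, w) := split t in (lCut v x L, w)
  | tPar m x y t => let: (L, w) := split t in (lPar m x y L, w)
  | tSub m v x t => let: (L, w) := split t in (lSub m v x L, w)
  | tDer e x t => let: (L, w) := split t in (lDer e x L, w)
  end.

Lemma splitK t : lplug (split t).1 (tVal (split t).2) = t.
Proof.
by elim: t => //= [v x t|m x y t|m v x t|e x t]; case: (split t) => L w /= ->.
Qed.

Lemma lplugK L v : split (lplug L (tVal v)) = (L, v).
Proof. by elim: L => //= [w x L ->|m x y L ->|m w x L ->|e x L ->]. Qed.

(** * General and multiplicative contexts *)

Inductive ctx :=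
| cVal of vctx
| cCut of vctx & var & term
| cSub of nat & vctx & var & term
| cLeft of lctx & ctx
with vctx :=
| vcHole
| vcPairL of ctx & term
| vcPairR of term & ctx
| vcLam of var & ctx
| vcBang of ctx.

(* Multiplicative contexts are the general contexts built without !C. *)
Fixpoint mult_ctx C : bool :=
  match C with
  | cVal V | cCut V _ _ | cSub _ V _ _ => mult_vctx V
  | cLeft _ C => mult_ctx C
  end
with mult_vctx V : bool :=
  match V with
  | vcHole => true
  | vcPairL C _ | vcPairR _ C | vcLam _ C => mult_ctx C
  | vcBang _ => false
  end.

(* The variables that a context binds at its hole. *)
Fixpoint capt C : {fset var} :=
  match C with
  | cVal V | cCut V _ _ | cSub _ V _ _ => captv V
  | cLeft L C => lcapt L `|` capt C
  end
with captv V : {fset var} :=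
  match V with
  | vcHole => fset0
  | vcPairL C _ | vcPairR _ C | vcBang C => capt C
  | vcLam x C => x |` capt C
  end.

(* For V other than the hole, [plugv V t] is a value, the left context given by
   [split] is empty, and plugging in [cCut V x s] and [cSub m V x s] is the
   ordinary one. *)
Fixpoint plug C t : term :=
  match C with
  | cVal V => plugv V t
  | cCut V x s => let: (L, v) := split (plugv V t) in lplug L (tCut v x s)
  | cSub m V x s => let: (L, v) := split (plugv V t) in lplug L (tSub m v x s)
  | cLeft L C => lplug L (plug C t)
  end
with plugv V t : term :=
  match V with
  | vcHole => t
  | vcPairL C s => tVal (vPair (plug C t) s)
  | vcPairR s C => tVal (vPair s (plug C t))
  | vcLam x C => tVal (vLam x (plug C t))
  | vcBang C => tVal (vBang (plug C t))
  end.

(* Plugging may capture the free variables of the plugged term, but when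
   cut(<.>,x.s)<L<v>> := L<cut(v,x.s)> moves s under L (and likewise for sub),
   the binders of L must not capture the free variables of x.s. On terms up to
   alpha this is a choice of the names bound by L. *)
Fixpoint plug_ok C t : bool :=
  match C with
  | cVal V => plugv_ok V t
  | cCut V x s =>
      plugv_ok V t && fdisjoint (lcapt (split (plugv V t)).1) (fv s `\ x)
  | cSub m V x s =>
      plugv_ok V t &&
      fdisjoint (lcapt (split (plugv V t)).1) (((Mul, m) : var) |` (fv s `\ x))
  | cLeft _ C => plug_ok C t
  end
with plugv_ok V t : bool :=
  match V with
  | vcHole => true
  | vcPairL C _ | vcPairR _ C | vcLam _ C | vcBang C => plug_ok C t
  end.

Definition plugs (C : ctx) (t u : term) : Prop := plug_ok C t /\ plug C t = u.

(** * Reduction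

    Each rule is stated on representatives whose bound names are such that no
    free variable of a subterm moved by the rule gets captured: this is what
    the [fdisjoint] and [\notin] premises say, besides the requirement that the
    context does not capture the cut variable. In [r_axm1] and [r_axe1] they
    make plugging capture-avoiding. *)

Inductive root : term -> term -> Prop :=
| r_axm1 v m M w w' :
    mult_value v -> mult_ctx M ->
    (Mul, m) \notin capt M -> fdisjoint (capt M) (fvv v) ->
    plugs M (tVal (vMul m)) w -> plugs M (tVal v) w' ->
    root (tCut v (Mul, m) w) w'
| r_axm2 n m t :
    (Mul, n) \notin bv t ->
    root (tCut (vMul n) (Mul, m) t) (ren Mul n m t)
| r_tensor L v L' v' m M x y t w w' :
    let s := lplug L (tVal v) in
    let u := lplug L' (tVal v') in
    mult_ctx M ->
    (Mul, m) \notin capt M -> fdisjoint (capt M) (fv s `|` fv u) ->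
    x \notin fv u ->
    fdisjoint (lcapt L) (fv u `|` (fv t `\ y `\ x)) ->
    fdisjoint (lcapt L') (fv t `\ y) ->
    plugs M (tPar m x y t) w ->
    plugs M (lplug L (tCut v x (lplug L' (tCut v' y t)))) w' ->
    root (tCut (vPair s u) (Mul, m) w) w'
| r_lolli L v' y m M v x t w w' :
    let s := lplug L (tVal v') in
    mult_ctx M ->
    (Mul, m) \notin capt M -> fdisjoint (capt M) (fvv (vLam y s)) ->
    y \notin fv t `\ x -> fdisjoint (lcapt L) (fv t `\ x) ->
    plugs M (tSub m v x t) w ->
    plugs M (tCut v y (lplug L (tCut v' x t))) w' ->
    root (tCut (vLam y s) (Mul, m) w) w'
| r_axe1 v e C w w' :
    exp_value v -> (Exp, e) \notin fvv v ->
    (Exp, e) \notin capt C -> fdisjoint (capt C) (fvv v) ->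
    plugs C (tVal (vExp e)) w -> plugs C (tVal v) w' ->
    root (tCut v (Exp, e) w) (tCut v (Exp, e) w')
| r_axe2 f e C x t w w' :
    f != e ->
    (Exp, e) \notin capt C -> (Exp, f) \notin capt C ->
    plugs C (tDer e x t) w -> plugs C (tDer f x t) w' ->
    root (tCut (vExp f) (Exp, e) w) (tCut (vExp f) (Exp, e) w')
| r_bang_der L v e C x t w w' :
    let s := lplug L (tVal v) in
    (Exp, e) \notin fv s ->
    (Exp, e) \notin capt C -> fdisjoint (capt C) (fv s) ->
    fdisjoint (lcapt L) (fv t `\ x) ->
    plugs C (tDer e x t) w -> plugs C (lplug L (tCut v x t)) w' ->
    root (tCut (vBang s) (Exp, e) w) (tCut (vBang s) (Exp, e) w')
| r_weak v e t :
    exp_value v -> (Exp, e) \notin fv t ->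
    root (tCut v (Exp, e) t) t.

Definition root_ms (t s : term) : Prop :=
  exists t' s', [/\ alpha t t', root t' s' & alpha s' s].

Definition step_ms (t s : term) : Prop :=
  exists C t0 s0 t' s',
    [/\ root_ms t0 s0, plugs C t0 t', plugs C s0 s', alpha t t' & alpha s' s].

(** * Typing *)

Inductive formula :=
| fAtom of nat
| fTensor of formula & formula
| fLolli of formula & formula
| fBang of formula.

Definition is_bang (A : formula) : bool := if A is fBang _ then true else false.

Definition tctx := {fmap var -> formula}.

Definition all_bang (G : tctx) : Prop := forall x A, G.[? x] = Some A -> is_bang A.

(* The comma of typing contexts. Since [G.[x <- A]] overwrites and [catf] is
   biased, every use below comes with the freshness or disjointness premises
   that make the comma meaningful. *)
Local Notation "G ',,' x ':>' A" := (G.[(x : var) <- A])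
  (at level 48, left associativity, x at level 40, A at level 40).

(* In [ty_cut] and [ty_sub] the binders of L must not capture what is moved
   under L; as for plugging, this is a choice of bound names. *)
Inductive typed : tctx -> term -> formula -> Prop :=
| ty_mvar m A :
    ~~ is_bang A -> typed ([fmap] ,, (Mul, m) :> A) (tVal (vMul m)) A
| ty_evar e A :
    typed ([fmap] ,, (Exp, e) :> fBang A) (tVal (vExp e)) (fBang A)
| ty_pair G D t s A B :
    typed G t A -> typed D s B -> fdisjoint (domf G) (domf D) ->
    typed (catf G D) (tVal (vPair t s)) (fTensor A B)
| ty_lam G x t A B :
    x \notin domf G -> typed (G ,, x :> A) t B ->
    typed G (tVal (vLam x t)) (fLolli A B)
| ty_cut G D L v x t A B :
    typed G (lplug L (tVal v)) A ->
    x \notin domf D -> typed (D ,, x :> A) t B ->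
    fdisjoint (domf G) (domf (D ,, x :> A)) ->
    fdisjoint (lcapt L) (fv t `\ x) ->
    typed (catf G D) (lplug L (tCut v x t)) B
| ty_par G m x y t A B C :
    x \notin domf G -> y \notin domf (G ,, x :> A) ->
    typed (G ,, x :> A ,, y :> B) t C ->
    (Mul, m) \notin domf (G ,, x :> A ,, y :> B) ->
    typed (G ,, (Mul, m) :> fTensor A B) (tPar m x y t) C
| ty_sub G D L v m x t A B C :
    typed G (lplug L (tVal v)) A ->
    x \notin domf D -> typed (D ,, x :> B) t C ->
    fdisjoint (domf G) (domf (D ,, x :> B)) ->
    (Mul, m) \notin domf G -> (Mul, m) \notin domf (D ,, x :> B) ->
    fdisjoint (lcapt L) (((Mul, m) : var) |` (fv t `\ x)) ->
    typed (catf G D ,, (Mul, m) :> fLolli A B) (lplug L (tSub m v x t)) C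
| ty_der G e x t A B :
    x \notin domf G -> typed (G ,, x :> A) t B ->
    (Exp, e) \notin domf (G ,, x :> A) ->
    typed (G ,, (Exp, e) :> fBang A) (tDer e x t) B
| ty_bang G t A :
    all_bang G -> typed G t A -> typed G (tVal (vBang t)) (fBang A)
| ty_weak G t A e B :
    typed G t A -> (Exp, e) \notin domf G ->
    typed (G ,, (Exp, e) :> fBang B) t A
| ty_contr G t A e f B :
    e != f -> (Exp, e) \notin domf G -> (Exp, f) \notin domf G ->
    typed (G ,, (Exp, e) :> fBang B ,, (Exp, f) :> fBang B) t A ->
    (Exp, e) \notin bv t ->
    typed (G ,, (Exp, e) :> fBang B) (ren Exp e f t) A
| ty_alpha G t t' A :
    typed G t A -> alpha t t' -> typed G t' A.

(* Main.v *)
(** Typing is equivalent to a syntax-directed judgement [sem] on raw terms, which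
    separates three concerns: simple typing in a total environment ([ty]); the
    condition that multiplicative binders bind exactly one occurrence and that
    boxes have no free multiplicative variable ([lin]); and the number of free
    occurrences of each variable ([cnt]). Exponential variables are shared and
    weakened freely. A term [L<cut(v,x.t)>] is then typed exactly as a cut of
    [L<v>] against [x.t], so that all the contexts become homomorphic. Reduction
    preserves [ty], [lin] and the count of every multiplicative variable, and
    creates no free exponential variable. To go back from [sem] to the typing
    rules, an exponential variable shared by the two parts of a term is renamed
    to a fresh one in the left part, and contracted afterwards. *)

From mathcomp Require Import all_boot zify.
Require Import Defs.

Set Implicit Arguments.
Unset Strict Implicit.
Unset Printing Implicit Defensive.

Local Open Scope fset_scope.
Local Open Scope fmap_scope.
Local Open Scope nat_scope.

(* The obstacle is inversion: weakening, contraction and alpha-conversion may end any derivation,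
   and the context of a term with two parts does not show how it was split. In [sem] the split can
   be read off the term, since the counts tell which part owns each multiplicative variable. The
   structural rules then matter only in the return to [typed], which does not mention reduction.
   Multiplicative counts must be preserved exactly, because those variables can be neither weakened
   nor contracted; exponential occurrences may multiply or vanish, but not appear from nothing.
   Copying and erasing respect this because the values concerned are exponential variables and
   boxes, which have no free multiplicative variable. Consuming a multiplicative cut variable
   respects it because the rules that do so act in contexts that cross no box, so that no box has to
   be checked again. *)
Scheme term_mind := Induction for term Sort Prop
  with value_mind := Induction for value Sort Prop.
Combined Scheme term_value_ind from term_mind, value_mind.
Scheme alpha_mind := Minimality for alpha Sort Prop
  with alphav_mind := Minimality for alphav Sort Prop.
Combined Scheme alpha_alphav_ind from alpha_mind, alphav_mind.
Scheme ctx_mind := Induction for ctx Sort Prop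
  with vctx_mind := Induction for vctx Sort Prop.
Combined Scheme ctx_vctx_ind from ctx_mind, vctx_mind.

(** * Occurrences, linearity and simple types *)

(** Binding and shadowing are boolean factors, so that statements on occurrences become arithmetic,
    settled by [lia] after splitting on the equalities. *)
Fixpoint cnt (z : var) t : nat :=
  match t with
  | tVal v => cntv z v
  | tCut v x t => cntv z v + (z != x) * cnt z t
  | tPar m x y t => (z == (Mul, m)) + (z != x) * ((z != y) * cnt z t)
  | tSub m v x t => (z == (Mul, m)) + (cntv z v + (z != x) * cnt z t)
  | tDer e x t => (z == (Exp, e)) + (z != x) * cnt z t
  end
with cntv z v :=
  match v with
  | vMul m => z == (Mul, m) : nat
  | vExp e => z == (Exp, e) : nat
  | vPair t s => cnt z t + cnt z s
  | vLam x t => (z != x) * cnt z t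
  | vBang t => cnt z t
  end.

Lemma mem_fv_fvv :
  (forall t z, (z \in fv t) = (0 < cnt z t)) /\
  (forall v z, (z \in fvv v) = (0 < cntv z v)).
Proof.
apply: term_value_ind => /=.
- by [].
- by move=> v IHv x t IH z; rewrite !inE IHv IH; case: eqP => /=; lia.
- by move=> m x y t IH z; rewrite !inE IH; do !case: eqP => //=; lia.
- by move=> m v IHv x t IH z; rewrite !inE IHv IH; do !case: eqP => //=; lia.
- by move=> e x t IH z; rewrite !inE IH; do !case: eqP => //=; lia.
- by move=> m z; rewrite !inE; case: eqP.
- by move=> m z; rewrite !inE; case: eqP.
- by move=> t IHt s IHs z; rewrite !inE IHt IHs; lia.
- by move=> x t IH z; rewrite !inE IH; case: eqP => //=; lia.
- by [].
Qed.
Definition mem_fv := mem_fv_fvv.1.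
Definition mem_fvv := mem_fv_fvv.2.

Definition once (x : var) (n : nat) : Prop := x.1 = Mul -> n = 1.

(** In [tPar] the factor [x != y] accounts for shadowing: a multiplicative [x] equal to [y] binds
    nothing and is rejected. Free multiplicative variables outside boxes are left to [sem_mul]. *)
Fixpoint lin t : Prop :=
  match t with
  | tVal v => linv v
  | tCut v x t => [/\ linv v, once x (cnt x t) & lin t]
  | tPar m x y t => [/\ once x ((x != y) * cnt x t), once y (cnt y t) & lin t]
  | tSub m v x t => [/\ linv v, once x (cnt x t) & lin t]
  | tDer e x t => once x (cnt x t) /\ lin t
  end
with linv v : Prop :=
  match v with
  | vMul _ | vExp _ => True
  | vPair t s => lin t /\ lin s
  | vLam x t => once x (cnt x t) /\ lin t
  | vBang t => (forall m, cnt (Mul, m) t = 0) /\ lin t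
  end.

Definition env := var -> formula.
Definition upd (r : env) (x : var) (A : formula) : env :=
  fun z => if z == x then A else r z.

(* Only exponential variables have types of the form [!B] in a derivable typing
   context, even when weakened; hence the check at every binder. *)
Definition kok (x : var) (A : formula) : bool := (x.1 == Exp) == is_bang A.

Fixpoint ty (r : env) t (C : formula) : Prop :=
  match t with
  | tVal v => tyv r v C
  | tCut v x t => exists A, [/\ kok x A, tyv r v A & ty (upd r x A) t C]
  | tPar m x y t => exists A B, [/\ r (Mul, m) = fTensor A B, kok x A, kok y B &
      ty (upd (upd r x A) y B) t C]
  | tSub m v x t => exists A B, [/\ r (Mul, m) = fLolli A B, kok x B, tyv r v A &
      ty (upd r x B) t C]
  | tDer e x t => exists A, [/\ r (Exp, e) = fBang A, kok x A & ty (upd r x A) t C]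
  end
with tyv r v C : Prop :=
  match v with
  | vMul m => r (Mul, m) = C
  | vExp e => r (Exp, e) = C
  | vPair t s => exists A B, [/\ C = fTensor A B, ty r t A & ty r s B]
  | vLam x t => exists A B, [/\ C = fLolli A B, kok x A & ty (upd r x A) t B]
  | vBang t => exists A, C = fBang A /\ ty r t A
  end.

(** Environments are functions compared pointwise, so every rearrangement of [upd] goes through this
    lemma; weakening and strengthening of [ty] are special cases. *)
Lemma ty_tyv_agree :
  (forall t r s A, (forall z, 0 < cnt z t -> r z = s z) -> ty r t A -> ty s t A) /\
  (forall v r s A, (forall z, 0 < cntv z v -> r z = s z) -> tyv r v A -> tyv s v A).
Proof.
apply: term_value_ind => /=.
- by move=> v IHv r s A e; apply: IHv => z /e.
- move=> v IHv x t IH r s A e [B [kB tv tt]]; exists B; split=> //.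
    by apply: IHv tv => z zv; apply: e; lia.
  apply: IH tt => z zt; rewrite /upd; case: eqP => // /eqP zx; apply: e.
  by rewrite zx; lia.
- move=> m x y t IH r s A e [B1 [B2 [rm k1 k2 tt]]]; exists B1, B2; split=> //.
    by rewrite -e // eqxx.
  apply: IH tt => z zt; rewrite /upd; case: eqP => // /eqP zy.
  case: eqP => // /eqP zx; apply: e.
  by rewrite zx zy; lia.
- move=> m v IHv x t IH r s A e [B1 [B2 [rm k1 tv tt]]]; exists B1, B2; split=> //.
  + by rewrite -e // eqxx.
  + by apply: IHv tv => z zv; apply: e; lia.
  apply: IH tt => z zt; rewrite /upd; case: eqP => // /eqP zx; apply: e.
  by rewrite zx; lia.
- move=> m x t IH r s A e [B [rm k1 tt]]; exists B; split=> //.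
    by rewrite -e // eqxx.
  apply: IH tt => z zt; rewrite /upd; case: eqP => // /eqP zx; apply: e.
  by rewrite zx; lia.
- by move=> m r s A e <-; rewrite e // eqxx.
- by move=> m r s A e <-; rewrite e // eqxx.
- move=> t IHt u IHu r s A e [B1 [B2 [-> t1 t2]]]; exists B1, B2; split=> //.
    by apply: IHt t1 => z zt; apply: e; lia.
  by apply: IHu t2 => z zt; apply: e; lia.
- move=> x t IH r s A e [B1 [B2 [-> k1 tt]]]; exists B1, B2; split=> //.
  apply: IH tt => z zt; rewrite /upd; case: eqP => // /eqP zx; apply: e.
  by rewrite zx; lia.
- by move=> t IH r s A e [B [-> tt]]; exists B; split=> //; apply: IH tt.
Qed.
Definition ty_agree := ty_tyv_agree.1.
Definition tyv_agree := ty_tyv_agree.2.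

Lemma ty_eq t r s A : r =1 s -> ty r t A <-> ty s t A.
Proof. by move=> e; split; apply: ty_agree => z _; rewrite e. Qed.

(** * Effect of a renaming on counts, linearity and types *)

Ltac blia := repeat match goal with |- context [@eq_op ?T ?a ?b] => case: (@eq_op T a b) => //= end;
  rewrite ?mul0n ?mul1n ?muln0 ?muln1; lia.

(* Additive form of the effect of a renaming on occurrences, valid also for
   [i = j]. *)
Lemma cnt_ren_renv k j i :
  (forall t z, (k, j) \notin bv t ->
    cnt z (ren k j i t) + (z == (k, i)) * cnt (k, i) t =
    cnt z t + (z == (k, j)) * cnt (k, i) t) /\
  (forall v z, (k, j) \notin bvv v ->
    cntv z (renv k j i v) + (z == (k, i)) * cntv (k, i) v =
    cntv z v + (z == (k, j)) * cntv (k, i) v).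
Proof.
have hd (k' : kind) m z :
    (z == (k', renn k j i k' m)) + (z == (k, i)) * ((k, i) == (k', m))
  = (z == (k', m)) + (z == (k, j)) * ((k, i) == (k', m)) :> nat.
  rewrite /renn !(eq_sym (k, i)) !xpair_eqE; case: z => a b; rewrite !xpair_eqE.
  case: (eqVneq k' k) => [->|] /=; last by rewrite !muln0.
  by case: (eqVneq m i) => [->|mi] /=; rewrite ?muln0 ?muln1 //= addnC.
have bd x t z t' : (k, j) != x -> t' = (if x == (k, i) then t else ren k j i t) ->
    (cnt z (ren k j i t) + (z == (k, i)) * cnt (k, i) t =
     cnt z t + (z == (k, j)) * cnt (k, i) t) ->
    (z != x) * cnt z t' + (z == (k, i)) * (((k, i) != x) * cnt (k, i) t) =
    (z != x) * cnt z t + (z == (k, j)) * (((k, i) != x) * cnt (k, i) t).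
  move=> jx ->; rewrite (eq_sym (k, i) x); case: (eqVneq x (k, i)) => /= xi.
    by lia.
  case: (eqVneq z x) => [->|_]; last lia.
  rewrite (negPf xi) (eq_sym x (k, j)) (negPf jx); lia.
apply: term_value_ind => /=.
- by [].
- move=> v IHv x t IH z; rewrite !inE !negb_or => /and3P[jv jx jt].
  have := IHv z jv; have := bd x t z _ jx erefl (IH z jt); blia.
- move=> m x y t IH z; rewrite !inE !negb_or => /and3P[jx jy jt].
  have := hd Mul m z.
  have := bd y t z _ jy erefl (IH z jt).
  rewrite (eq_sym (k, i) x); case: (eqVneq x (k, i)) => [->|xi] /=; first by blia.
  case: (eqVneq z x) => [->|_] /=; last by blia.
  by rewrite (negPf xi) (eq_sym x (k, j)) (negPf jx); blia.
- move=> m v IHv x t IH z; rewrite !inE !negb_or => /and3P[jv jx jt].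
  have := hd Mul m z.
  have := IHv z jv; have := bd x t z _ jx erefl (IH z jt); blia.
- move=> m x t IH z; rewrite !inE !negb_or => /andP[jx jt].
  have := hd Exp m z; have := bd x t z _ jx erefl (IH z jt); blia.
- by move=> m z _; apply: hd.
- by move=> m z _; apply: hd.
- move=> t IHt s IHs z; rewrite inE negb_or => /andP[jt js].
  have := IHt z jt; have := IHs z js; blia.
- move=> x t IH z; rewrite !inE !negb_or => /andP[jx jt].
  exact: bd jx erefl (IH z jt).
- by [].
Qed.
Definition cnt_ren k j i := (cnt_ren_renv k j i).1.

Lemma bv_ren_renv k j i :
  (forall t, bv (ren k j i t) = bv t) /\ (forall v, bvv (renv k j i v) = bvv v).
Proof.
apply: term_value_ind => //=.
- by move=> v -> x t IH; case: ifP; rewrite ?IH.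
- by move=> m x y t IH; case: ifP; rewrite ?IH.
- by move=> m v -> x t IH; case: ifP; rewrite ?IH.
- by move=> m x t IH; case: ifP; rewrite ?IH.
- by move=> t -> s ->.
- by move=> x t IH; case: ifP; rewrite ?IH.
Qed.
Definition bv_ren k j i := (bv_ren_renv k j i).1.

Lemma lin_ren_renv k j i :
  (forall t, (k, j) \notin bv t -> lin (ren k j i t) <-> lin t) /\
  (forall v, (k, j) \notin bvv v -> linv (renv k j i v) <-> linv v).
Proof.
have cb x t : (k, j) != x -> (k, j) \notin bv t -> x != (k, i) ->
    cnt x (ren k j i t) = cnt x t.
  move=> jx jt xi; have := cnt_ren i x jt.
  by rewrite (negPf xi) (eq_sym x (k, j)) (negPf jx) !addn0.
have bd x t : (k, j) != x -> (k, j) \notin bv t -> (lin (ren k j i t) <-> lin t) ->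
  let t' := if x == (k, i) then t else ren k j i t in
  (once x (cnt x t') <-> once x (cnt x t)) /\ (lin t' <-> lin t).
  by move=> jx jt IH /=; case: (eqVneq x (k, i)) => // xi; rewrite cb.
apply: term_value_ind => //=.
- move=> v IHv x t IH; rewrite !inE !negb_or => /and3P[jv jx jt].
  have := IHv jv; have [] := bd x t jx jt (IH jt).
  by move=> e1 e2 e3; split=> -[h1 h2 h3]; split; tauto.
- move=> m x y t IH; rewrite !inE !negb_or => /and3P[jx jy jt].
  have [e1 e2] := bd x t jx jt (IH jt).
  have [f1 f2] := bd y t jy jt (IH jt).
  case: (eqVneq x (k, i)) => xi /=; first by [].
  case: (eqVneq y (k, i)) => yi //=; rewrite !cb //.
  by have := IH jt; split=> -[h1 h2 h3]; split; tauto.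
- move=> m v IHv x t IH; rewrite !inE !negb_or => /and3P[jv jx jt].
  have := IHv jv; have [] := bd x t jx jt (IH jt).
  by move=> e1 e2 e3; split=> -[h1 h2 h3]; split; tauto.
- move=> m x t IH; rewrite !inE !negb_or => /andP[jx jt].
  by have [] := bd x t jx jt (IH jt); tauto.
- move=> t IHt s IHs; rewrite inE negb_or => /andP[jt js].
  by have := IHt jt; have := IHs js; tauto.
- move=> x t IH; rewrite !inE !negb_or => /andP[jx jt].
  by have [] := bd x t jx jt (IH jt); tauto.
- move=> t IH jt; rewrite (IH jt); have e z := cnt_ren i z jt.
  split=> -[c l]; split=> // m; have := e (Mul, m); rewrite c.
    case: k jt c e {IH cb bd} => jt c e /=; last by blia.
    (* The equation at [(Mul, j)] shows that [(Mul, i)] does not occur in [t] either, unless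
       [i = j], where the two correction terms cancel. *)
    by have := e (Mul, j); rewrite c eqxx; case: eqP => [[->]|]; blia.
  by case: k {jt IH cb bd e l} => /=; rewrite ?c; blia.
Qed.
Definition lin_ren k j i := (lin_ren_renv k j i).1.

(** Renaming [i] to [j] amounts to reading [i] at [j] in the environment. The variable [j] may
    already be free in [t], so contraction, which merges two variables, is covered. *)
Lemma ty_ren_renv k j i :
  (forall t r A, (k, j) \notin bv t ->
    ty r (ren k j i t) A <-> ty (upd r (k, i) (r (k, j))) t A) /\
  (forall v r A, (k, j) \notin bvv v ->
    tyv r (renv k j i v) A <-> tyv (upd r (k, i) (r (k, j))) v A).
Proof.
have hd (r : env) k' m :
    r (k', renn k j i k' m) = upd r (k, i) (r (k, j)) (k', m).
  rewrite /upd /renn xpair_eqE.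
  by case: (eqVneq k' k) => [->|_] /=; case: (m == i).
have bd (r : env) x t A B : (k, j) != x ->
    (forall r A, ty r (ren k j i t) A <-> ty (upd r (k, i) (r (k, j))) t A) ->
    ty (upd r x B) (if x == (k, i) then t else ren k j i t) A <->
    ty (upd (upd r (k, i) (r (k, j))) x B) t A.
  move=> jx IH; case: (eqVneq x (k, i)) => [->|xi]; last rewrite IH.
    by apply: ty_eq => z; rewrite /upd; case: eqP.
  apply: ty_eq => z; rewrite /upd (negPf jx); case: eqP => [->|//].
  by rewrite eq_sym (negPf xi).
apply: term_value_ind => //=.
- move=> v IHv x t IH r A; rewrite !inE !negb_or => /and3P[jv jx jt].
  have bx B := bd r x t A B jx (fun r A => IH r A jt).
  split=> -[B [kB tv tt]]; exists B; split=> //.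
  + exact/IHv.
  + exact/bx.
  + exact/IHv.
  + exact/bx.
- move=> m x y t IH r A; rewrite !inE !negb_or => /and3P[jx jy jt].
  have bx B := bd r x t A B jx (fun r A => IH r A jt).
  have e B1 B2 : ty (upd (upd r x B1) y B2)
      (if (x == (k, i)) || (y == (k, i)) then t else ren k j i t) A <->
      ty (upd (upd (upd r (k, i) (r (k, j))) x B1) y B2) t A.
    case: (eqVneq x (k, i)) => [->|xi] /=.
      by apply: ty_eq => z; rewrite /upd; do !case: eqP.
    rewrite (bd _ y t A B2 jy (fun r A => IH r A jt)).
    apply: ty_eq => z; rewrite /upd (negPf jx); case: eqP => // _.
    by case: eqP => [->|//]; rewrite eq_sym (negPf xi).
  by split=> -[B1 [B2 [rm k1 k2 tt]]]; exists B1, B2; split=> //;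
    first [by rewrite hd | by rewrite -hd | exact/e].
- move=> m v IHv x t IH r A; rewrite !inE !negb_or => /and3P[jv jx jt].
  have bx B := bd r x t A B jx (fun r A => IH r A jt).
  by split=> -[B1 [B2 [rm k1 tv tt]]]; exists B1, B2; split=> //;
    first [by rewrite hd | by rewrite -hd | exact/IHv | exact/bx].
- move=> m x t IH r A; rewrite !inE !negb_or => /andP[jx jt].
  have bx B := bd r x t A B jx (fun r A => IH r A jt).
  by split=> -[B1 [rm k1 tt]]; exists B1; split=> //;
    first [by rewrite hd | by rewrite -hd | exact/bx].
- by move=> m r A _; rewrite hd.
- by move=> m r A _; rewrite hd.
- move=> t IHt u IHu r A; rewrite !inE !negb_or => /andP[jt ju].
  by split=> -[B1 [B2 [-> t1 t2]]]; exists B1, B2; split=> //; first [exact/IHt | exact/IHu].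
- move=> x t IH r A; rewrite !inE !negb_or => /andP[jx jt].
  have bx B1 B := bd r x t B1 B jx (fun r A => IH r A jt).
  by split=> -[B1 [B2 [-> k1 tt]]]; exists B1, B2; split=> //; exact/bx.
- by move=> t IH r A jt; split=> -[B [-> tt]]; exists B; split=> //; exact/IH.
Qed.
Definition ty_ren k j i := (ty_ren_renv k j i).1.

(** The measure for the return to [typed], where a term is replaced by alpha-variants and renamings:
    these break structural induction but keep this size. *)
Fixpoint sz t : nat :=
  match t with
  | tVal v => szv v
  | tCut v _ t | tSub _ v _ t => (szv v + sz t).+1
  | tPar _ _ _ t | tDer _ _ t => (sz t).+1
  end
with szv v : nat :=
  match v with
  | vMul _ | vExp _ => 0
  | vPair t s => (sz t + sz s).+1
  | vLam _ t | vBang t => (sz t).+1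
  end.

Lemma sz_ren_renv k j i :
  (forall t, sz (ren k j i t) = sz t) /\ (forall v, szv (renv k j i v) = szv v).
Proof.
apply: term_value_ind => //=.
- by move=> v -> x t IH; case: ifP; rewrite ?IH.
- by move=> m x y t IH; case: ifP; rewrite ?IH.
- by move=> m v -> x t IH; case: ifP; rewrite ?IH.
- by move=> m x t IH; case: ifP; rewrite ?IH.
- by move=> t -> s ->.
- by move=> x t IH; case: ifP; rewrite ?IH.
- by move=> t ->.
Qed.
Definition sz_ren k j i := (sz_ren_renv k j i).1.

(** * Alpha-equivalence *)

(** Lets [rewrite] use equivalences inside [[/\ _, _ & _]]. *)
#[local] Instance and3_iff :
  Morphisms.Proper
    (Morphisms.respectful iff (Morphisms.respectful iff (Morphisms.respectful iff iff)))
    and3.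
Proof. by move=> P P' p Q Q' q R R' r; split=> -[*]; split; tauto. Qed.

(** All that is ever extracted from an alpha-equivalence, which is thus never inverted. *)
Definition sim t s := [/\ forall z, cnt z t = cnt z s, lin t <-> lin s,
  forall r A, ty r t A <-> ty r s A & sz t = sz s].
Definition simv v w := [/\ forall z, cntv z v = cntv z w, linv v <-> linv w,
  forall r A, tyv r v A <-> tyv r w A & szv v = szv w].

(** Here [x] stands for the other binder of a [tPar]; the cases with one binder instantiate it with
    [(k, j.+1)], some variable other than [(k, j)]. *)
Lemma sim_ren (k : kind) (i j : nat) (x : var) t : (k, j) != x -> unused (k, j) t ->
  [/\ forall z, (z != (k, j)) * cnt z (ren k j i t) = (z != (k, i)) * cnt z t,
      cnt x (ren k j i t) = (x != (k, i)) * cnt x t, cnt (k, j) (ren k j i t) = cnt (k, i) t,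
      lin (ren k j i t) <-> lin t & sz (ren k j i t) = sz t] /\
  forall r B A, ty (upd r (k, j) B) (ren k j i t) A <-> ty (upd r (k, i) B) t A.
Proof.
move=> jx; rewrite /unused inE negb_or mem_fv -leqNgt leqn0 => /andP[/eqP jt jb].
have e z := cnt_ren i z jb.
have ez z : (z != (k, j)) * cnt z (ren k j i t) = (z != (k, i)) * cnt z t.
  have := e z; case: (eqVneq z (k, j)) => [->|zj] /=; first by rewrite jt; blia.
  by case: (eqVneq z (k, i)) => [->|zi]; blia.
split; first split=> //.
- by have := ez x; rewrite (eq_sym x (k, j)) jx mul1n.
- by have := e (k, j); rewrite jt eqxx; case: eqP => [<-|_]; rewrite ?jt; blia.
- exact: lin_ren.
- exact: sz_ren.
move=> r B A; rewrite ty_ren //; split; apply: ty_agree => z zt.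
  rewrite /upd eqxx; case: (eqVneq z) => // _; case: (eqVneq z) => // zj.
  by move: zt; rewrite zj jt.
rewrite /upd eqxx; case: (eqVneq z) => // _; case: (eqVneq z) => // zj.
by move: zt; rewrite zj jt.
Qed.

Lemma sim_alpha_alphav :
  (forall t s, alpha t s -> sim t s) /\ (forall v w, alphav v w -> simv v w).
Proof.
apply: alpha_alphav_ind.
- by move=> t; split.
- by move=> t s _ [h1 h2 h3 h4]; split=> // [|r A]; rewrite ?h2 ?h3.
- move=> t s u _ [h1 h2 h3 h4] _ [g1 g2 g3 g4].
  by split=> [z||r A|]; rewrite ?h1 ?h2 ?h3 ?h4.
- by move=> v w _ [h1 h2 h3 h4].
- move=> v w x t s _ [h1 h2 h3 h4] _ [g1 g2 g3 g4].
  split=> [z||r A|] /=; rewrite ?h1 ?h4 ?g1 ?g4 //; first by rewrite h2 g2.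
  by split=> -[B [kB tv tt]]; exists B; split=> //; first [exact/h3 | exact/g3].
- move=> m x y t s _ [g1 g2 g3 g4].
  split=> [z||r A|] /=; rewrite ?g1 ?g4 //; first by rewrite g2.
  by split=> -[B [B' [rm kB kB' tt]]]; exists B, B'; split=> //; exact/g3.
- move=> m v w x t s _ [h1 h2 h3 h4] _ [g1 g2 g3 g4].
  split=> [z||r A|] /=; rewrite ?h1 ?h4 ?g1 ?g4 //; first by rewrite h2 g2.
  by split=> -[B [B' [rm kB tv tt]]]; exists B, B'; split=> //; first [exact/h3 | exact/g3].
- move=> m x t s _ [g1 g2 g3 g4].
  split=> [z||r A|] /=; rewrite ?g1 ?g4 //; first by rewrite g2.
  by split=> -[B [rm kB tt]]; exists B; split=> //; exact/g3.
- move=> v k i j t jt.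
  have jx : (k, j) != (k, j.+1) by rewrite xpair_eqE eqxx /=; lia.
  have [[ez _ e1 e2 e3] e4] := sim_ren i jx jt.
  split=> [z||r A|] /=; rewrite ?ez ?e3 ?e1 ?e2 //.
  by split=> -[B [kB tv tt]]; exists B; split=> //; exact/e4.
- move=> m k i j y t jt jy.
  have [[ez ex e1 e2 e3] e4] := sim_ren i jy jt.
  case: (eqVneq (k, i) y) => [iy|iy].
    have jt0 : cnt (k, j) t = 0 by move: jt; rewrite /unused inE negb_or mem_fv; lia.
    subst y; split=> [z||r A|] //=.
    + case: (eqVneq z (k, j)) => [->|zj]; last by blia.
      by rewrite jt0; blia.
    + by rewrite eqxx jt0 muln0.
    split=> -[B [B' [rm kB kB' tt]]]; exists B, B'; split=> //; move: tt;
      apply: ty_agree => z zt; rewrite /upd; case: eqP => //; case: eqP => // zj.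
      by subst z; move: jt; rewrite /unused inE negb_or mem_fv zt.
    by subst z; move: jt; rewrite /unused inE negb_or mem_fv zt.
  split=> [z||r A|] /=.
  + by have := ez z; blia.
  + rewrite e2 jy iy e1 ex (eq_sym y) iy !mul1n.
    by [].
  + have sw B B' x t0 : x != y -> ty (upd (upd r x B) y B') t0 A <->
       ty (upd (upd r y B') x B) t0 A.
      move=> xy; apply: ty_eq => z; rewrite /upd.
      by case: (eqVneq z y) => // ->; rewrite eq_sym (negPf xy).
    split=> -[B [B' [rm kB kB' tt]]]; exists B, B'; split=> //; move: tt.
      by rewrite !sw // e4.
    by rewrite !sw // e4.
  + by rewrite e3.
- move=> m x k i j t jt jx.
  have [[ez ex e1 e2 e3] e4] := sim_ren i jx jt.
  split=> [z||r A|] /=; rewrite ?ez ?e3 ?e1 ?e2 ?ex //.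
  by split=> -[B [B' [rm kB kB' tt]]]; exists B, B'; split=> //; exact/e4.
- move=> m v k i j t jt.
  have jx : (k, j) != (k, j.+1) by rewrite xpair_eqE eqxx /=; lia.
  have [[ez _ e1 e2 e3] e4] := sim_ren i jx jt.
  split=> [z||r A|] /=; rewrite ?ez ?e3 ?e1 ?e2 //.
  by split=> -[B [B' [rm kB tv tt]]]; exists B, B'; split=> //; exact/e4.
- move=> m k i j t jt.
  have jx : (k, j) != (k, j.+1) by rewrite xpair_eqE eqxx /=; lia.
  have [[ez _ e1 e2 e3] e4] := sim_ren i jx jt.
  split=> [z||r A|] /=; rewrite ?ez ?e3 ?e1 ?e2 //.
  by split=> -[B [rm kB tt]]; exists B; split=> //; exact/e4.
- by move=> t; split.
- by move=> t s _ [h1 h2 h3 h4]; split=> // [|r A]; rewrite ?h2 ?h3.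
- move=> t s u _ [h1 h2 h3 h4] _ [g1 g2 g3 g4].
  by split=> [z||r A|]; rewrite ?h1 ?h2 ?h3 ?h4.
- move=> t t' s s' _ [h1 h2 h3 h4] _ [g1 g2 g3 g4].
  split=> [z||r A|] /=; rewrite ?h1 ?h4 ?g1 ?g4 //; first by rewrite h2 g2.
  by split=> -[B [B' [-> tv tt]]]; exists B, B'; split=> //; first [exact/h3 | exact/g3].
- move=> x t s _ [g1 g2 g3 g4].
  split=> [z||r A|] /=; rewrite ?g1 ?g4 //; first by rewrite g2.
  by split=> -[B [B' [-> kB tt]]]; exists B, B'; split=> //; exact/g3.
- move=> t s _ [g1 g2 g3 g4].
  split=> [z||r A|] /=; rewrite ?g1 ?g4 //.
    by split=> -[c /g2 l]; split=> // m; move: (c m); rewrite g1.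
  by split=> -[B [-> tt]]; exists B; split=> //; exact/g3.
- move=> k i j t jt.
  have jx : (k, j) != (k, j.+1) by rewrite xpair_eqE eqxx /=; lia.
  have [[ez _ e1 e2 e3] e4] := sim_ren i jx jt.
  split=> [z||r A|] /=; rewrite ?ez ?e3 ?e1 ?e2 //.
  by split=> -[B [B' [-> kB tt]]]; exists B, B'; split=> //; exact/e4.
Qed.
Definition sim_alpha := sim_alpha_alphav.1.

(** * Moving a cut or a sub under a left context *)

(* [L<v>] becomes [L<K v>]: the operation behind plugging in [cut(<.>,x.s)] and
   [sub(m,<.>,x.s)]. *)
Definition wrap (K : value -> term) u := let: (L, v) := split u in lplug L (K v).
Notation spine u := (lcapt (split u).1).

(* A binary term former with a value as first argument: [c], [P] and [Q] are what
   the second argument contributes to [cnt], [lin] and [ty]. *)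
Record frame (K : value -> term) (c : var -> nat) (P : Prop)
    (Q : env -> formula -> formula -> Prop) : Prop := Frame {
  frame_cnt : forall z v, cnt z (K v) = cntv z v + c z;
  frame_lin : forall v, lin (K v) <-> linv v /\ P;
  frame_ty : forall r v B, ty r (K v) B <-> exists A, tyv r v A /\ Q r A B;
  frame_agree : forall r s A B, (forall z, 0 < c z -> r z = s z) -> Q r A B -> Q s A B }.

Definition cut_cnt (x : var) s (z : var) := (z != x) * cnt z s.
Definition cut_lin x s := once x (cnt x s) /\ lin s.
Definition cut_ty x s r A B := kok x A /\ ty (upd r x A) s B.
Definition sub_cnt m (x : var) s (z : var) := (z == (Mul, m)) + (z != x) * cnt z s.
Definition sub_ty m x s (r : env) A B :=
  exists A', [/\ r (Mul, m) = fLolli A A', kok x A' & ty (upd r x A') s B].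

Lemma upd_agree (x : var) s (r r' : env) A : (forall z, 0 < (z != x) * cnt z s -> r z = r' z) ->
  forall z, 0 < cnt z s -> upd r x A z = upd r' x A z.
Proof. by move=> e z zs; rewrite /upd; case: eqP => // /eqP zx; apply: e; rewrite zx mul1n. Qed.

Lemma cut_frame x s : frame (fun v => tCut v x s) (cut_cnt x s) (cut_lin x s) (cut_ty x s).
Proof.
split=> //=.
- by rewrite /cut_lin => v; split; [case | case=> ? []].
- by move=> r v B; split=> -[A]; [case=> k1 t1 t2 | case=> t1 [k1 t2]]; exists A.
- by move=> r s' A B e [k1 t2]; split=> //; apply: ty_agree t2; exact: upd_agree.
Qed.

Lemma sub_frame m x s :
  frame (fun v => tSub m v x s) (sub_cnt m x s) (cut_lin x s) (sub_ty m x s).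
Proof.
split=> /=.
- by rewrite /sub_cnt => z v; lia.
- by rewrite /cut_lin => v; split; [case | case=> ? []].
- move=> r v B; split=> -[A]; [case=> A' [rm k1 t1 t2] | case=> t1 [A' [rm k1 t2]]].
    by exists A; split=> //; exists A'.
  by exists A, A'.
- move=> r s' A B e [A' [rm k1 t2]]; exists A'; split=> //.
    by rewrite -e // /sub_cnt eqxx.
  apply: ty_agree t2; apply: upd_agree => z zs; apply: e.
  by rewrite /sub_cnt; lia.
Qed.

Section Wrap.
Variables (K : value -> term) (c : var -> nat) (P : Prop).
Variable Q : env -> formula -> formula -> Prop.
Hypothesis fK : frame K c P Q.

(** Induction along the spine of [u], which [wrap K u] shares with it; the absence of capture
    reaches each step as [c x = 0] for the binder at hand. *)
Lemma wrap_ind (R : term -> term -> Prop) :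
  (forall v, R (tVal v) (K v)) ->
  (forall v x t t', c x = 0 -> R t t' -> R (tCut v x t) (tCut v x t')) ->
  (forall m x y t t', c x = 0 -> c y = 0 -> R t t' -> R (tPar m x y t) (tPar m x y t')) ->
  (forall m v x t t', c x = 0 -> R t t' -> R (tSub m v x t) (tSub m v x t')) ->
  (forall e x t t', c x = 0 -> R t t' -> R (tDer e x t) (tDer e x t')) ->
  forall u, (forall z, z \in spine u -> c z = 0) -> R u (wrap K u).
Proof.
move=> Rv Rc Rp Rs Rd; rewrite /wrap.
elim=> [v _|v x t|m x y t|m v x t|e x t]; rewrite //=; case: (split t) => L w /= IH H.
- apply: Rc; first by apply: H; rewrite !inE eqxx.
  by apply: IH => z zL; apply: H; rewrite !inE zL orbT.
- apply: Rp; first by apply: H; rewrite !inE eqxx.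
    by apply: H; rewrite !inE eqxx orbT.
  by apply: IH => z zL; apply: H; rewrite !inE zL !orbT.
- apply: Rs; first by apply: H; rewrite !inE eqxx.
  by apply: IH => z zL; apply: H; rewrite !inE zL orbT.
- apply: Rd; first by apply: H; rewrite !inE eqxx.
  by apply: IH => z zL; apply: H; rewrite !inE zL orbT.
Qed.

Lemma cnt_wrap u : (forall z, z \in spine u -> c z = 0) ->
  forall z, cnt z (wrap K u) = cnt z u + c z.
Proof.
move: u; apply: (@wrap_ind (fun u w => forall z, cnt z w = cnt z u + c z))
  => /= [v z|v x t t' cx e z|m x y t t' cx cy e z|m v x t t' cx e z|a x t t' cx e z].
- exact: (frame_cnt fK).
- by rewrite e; case: eqP => [->|_]; rewrite ?cx; lia.
- by rewrite e; case: (z =P x) => [->|_]; rewrite ?cx; [lia|];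
    case: (z =P y) => [->|_]; rewrite ?cy; lia.
- by rewrite e; case: (z =P x) => [->|_]; rewrite ?cx; lia.
- by rewrite e; case: (z =P x) => [->|_]; rewrite ?cx; lia.
Qed.

Lemma lin_wrap u : (forall z, z \in spine u -> c z = 0) ->
  lin (wrap K u) <-> lin u /\ P.
Proof.
(* The counts are carried along because each spine binder has to occur as often in the wrapped body
   as in the original one. *)
move=> H; suff [] : (forall z, cnt z (wrap K u) = cnt z u + c z) /\
  (lin (wrap K u) <-> lin u /\ P) by [].
move: u H; apply: (@wrap_ind (fun u w =>
  (forall z, cnt z w = cnt z u + c z) /\ (lin w <-> lin u /\ P)))
  => /= [v|v x t t' cx [e IH]|m x y t t' cx cy [e IH]|m v x t t' cx [e IH]|a x t t' cx [e IH]].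
- by split=> [z|]; [exact: (frame_cnt fK) | exact: (frame_lin fK)].
- rewrite !e cx addn0; split=> [z|]; last first.
    by split=> [[h1 h2 /IH[h3 h4]]|[[h1 h2 h3] h4]]; do ?split=> //; apply/IH.
  by rewrite e; case: eqP => [->|_]; rewrite ?cx; lia.
- rewrite !e cx cy !addn0; split=> [z|]; last first.
    by split=> [[h1 h2 /IH[h3 h4]]|[[h1 h2 h3] h4]]; do ?split=> //; apply/IH.
  by rewrite e; case: (z =P x) => [->|_]; rewrite ?cx; [lia|];
    case: (z =P y) => [->|_]; rewrite ?cy; lia.
- rewrite !e cx addn0; split=> [z|]; last first.
    by split=> [[h1 h2 /IH[h3 h4]]|[[h1 h2 h3] h4]]; do ?split=> //; apply/IH.
  by rewrite e; case: (z =P x) => [->|_]; rewrite ?cx; lia.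
- rewrite !e cx addn0; split=> [z|]; last tauto.
  by rewrite e; case: (z =P x) => [->|_]; rewrite ?cx; lia.
Qed.

(** No spine binder occurs in the second argument, so [Q] holds under the spine exactly when it
    holds outside of it. *)
Lemma ty_wrap u : (forall z, z \in spine u -> c z = 0) -> forall r B,
  ty r (wrap K u) B <-> exists A, ty r u A /\ Q r A B.
Proof.
have Qx r x A B1 B2 : c x = 0 -> Q (upd r x A) B1 B2 <-> Q r B1 B2.
  by move=> cx; split; apply: (frame_agree fK) => z; rewrite /upd; case: eqP => // ->;
    rewrite cx.
move: u; apply: (@wrap_ind (fun u w => forall r B,
  ty r w B <-> exists A, ty r u A /\ Q r A B))
  => /= [v|v x t t' cx IH|m x y t t' cx cy IH|m v x t t' cx IH|a x t t' cx IH] r B.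
- exact: (frame_ty fK).
- split=> [[A [k1 tv /IH[A' [tt q]]]]|[A' [[A [k1 tv tt]] q]]].
    by exists A'; split; [exists A | move: q; rewrite Qx].
  by exists A; split=> //; apply/IH; exists A'; split=> //; apply/Qx.
- split=> [[A1 [A2 [e k1 k2 /IH[A' [tt q]]]]]|[A' [[A1 [A2 [e k1 k2 tt]]] q]]].
    by exists A'; split; [exists A1, A2 | move: q; rewrite !Qx].
  by exists A1, A2; split=> //; apply/IH; exists A'; split=> //; rewrite !Qx.
- split=> [[A1 [A2 [e k1 tv /IH[A' [tt q]]]]]|[A' [[A1 [A2 [e k1 tv tt]]] q]]].
    by exists A'; split; [exists A1, A2 | move: q; rewrite !Qx].
  by exists A1, A2; split=> //; apply/IH; exists A'; split=> //; rewrite !Qx.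
- split=> [[A1 [e k1 /IH[A' [tt q]]]]|[A' [[A1 [e k1 tt]] q]]].
    by exists A'; split; [exists A1 | move: q; rewrite !Qx].
  by exists A1; split=> //; apply/IH; exists A'; split=> //; rewrite !Qx.
Qed.
End Wrap.

Lemma wrap_lplug K L v : wrap K (lplug L (tVal v)) = lplug L (K v).
Proof. by rewrite /wrap lplugK. Qed.
Lemma cut_lplug L v x t :
  lplug L (tCut v x t) = wrap (fun v => tCut v x t) (lplug L (tVal v)).
Proof. by rewrite wrap_lplug. Qed.
Lemma spine_lplug L v : spine (lplug L (tVal v)) = lcapt L.
Proof. by rewrite lplugK. Qed.

Lemma disj_cut (X : {fset var}) x s : fdisjoint X (fv s `\ x) ->
  forall z, z \in X -> cut_cnt x s z = 0.
Proof.
move=> /fdisjointP d z /d; rewrite !inE mem_fv /cut_cnt.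
by case: eqP => //= _; lia.
Qed.

Lemma disj_sub (X : {fset var}) m x s :
  fdisjoint X (((Mul, m) : var) |` (fv s `\ x)) ->
  forall z, z \in X -> sub_cnt m x s z = 0.
Proof.
move=> /fdisjointP d z /d; rewrite !inE mem_fv /sub_cnt.
by do 2 case: eqP => //= _; lia.
Qed.

(** * From typing to the syntax-directed judgement *)

Definition wfc (G : tctx) := forall x A, G.[? x] = Some A -> kok x A.
(** Totalised with [fAtom 0]; [sem_dom] ensures that the free variables of a term take their types
    from [G]. *)
Definition env_of (G : tctx) : env := fun x => odflt (fAtom 0) G.[? x].

Lemma domE (G : tctx) x : (x \in domf G) = isSome G.[? x].
Proof. by rewrite fndSome. Qed.

Lemma disj_domP (G D : tctx) : fdisjoint (domf G) (domf D) ->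
  forall x, isSome G.[? x] -> D.[? x] = None.
Proof.
by move=> /fdisjointP d x; rewrite -domE => /d; rewrite domE; case: D.[? x].
Qed.

(** In [sem_mul] the boolean is coerced to 0 or 1: a multiplicative variable occurs exactly once if
    it is declared, and never otherwise. The one-sided [sem_exp] absorbs weakening and
    contraction. *)
Record sem (G : tctx) t A : Prop := Sem {
  sem_wf : wfc G;
  sem_lin : lin t;
  sem_mul : forall m, cnt (Mul, m) t = isSome G.[? (Mul, m)];
  sem_exp : forall e, 0 < cnt (Exp, e) t -> isSome G.[? (Exp, e)];
  sem_ty : ty (env_of G) t A }.

Lemma sem_dom G t A z : sem G t A -> 0 < cnt z t -> isSome G.[? z].
Proof. by case: z => -[] z s; [rewrite (sem_mul s) lt0b | exact: (sem_exp s)]. Qed.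

Lemma sem_agree G t A r : sem G t A ->
  (forall z B, G.[? z] = Some B -> r z = B) -> ty r t A.
Proof.
move=> s e; apply: ty_agree (sem_ty s) => z /(sem_dom s).
by rewrite /env_of; case E: G.[? z] => [B|] //= _; rewrite (e _ _ E).
Qed.

Lemma sem_sim G t s A : sim t s -> sem G t A -> sem G s A.
Proof.
move=> [c l tE _] [w lt cm ce tt]; split=> //; first exact/l.
- by move=> m; rewrite -c.
- by move=> e; rewrite -c; apply: ce.
- exact/tE.
Qed.

Lemma env_cat (G D : tctx) : fdisjoint (domf G) (domf D) ->
  forall z B, (G.[? z] = Some B \/ D.[? z] = Some B) -> env_of (catf G D) z = B.
Proof.
move=> d z B; rewrite /env_of fnd_cat domE => -[] e; last by rewrite e.
by rewrite (disj_domP d) e.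
Qed.

Lemma wfc_cat (G D : tctx) : wfc G -> wfc D -> wfc (catf G D).
Proof. by move=> wG wD x A; rewrite fnd_cat; case: ifP => _; [apply: wD | apply: wG]. Qed.

Lemma wfc_set (G : tctx) x A : wfc G -> kok x A -> wfc G.[x <- A].
Proof. by move=> wG k y B; rewrite fnd_set; case: eqP => [-> [<-]|_ /wG]. Qed.

Lemma wfc_unset (G : tctx) (x : var) A : x \notin domf G -> wfc G.[x <- A] -> wfc G /\ kok x A.
Proof.
rewrite domE => xG w; split; last by apply: (w x); rewrite fnd_set eqxx.
move=> y B e; apply: w; rewrite fnd_set; case: eqP => // yx.
by move: xG; rewrite -yx e.
Qed.

Lemma env_upd (G : tctx) x A : env_of G.[x <- A] =1 upd (env_of G) x A.
Proof. by move=> z; rewrite /env_of /upd fnd_set; case: eqP. Qed.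

Lemma sem_pair G D t s A B : sem G t A -> sem D s B ->
  fdisjoint (domf G) (domf D) -> sem (catf G D) (tVal (vPair t s)) (fTensor A B).
Proof.
move=> st ss d; split=> /=.
- exact: wfc_cat (sem_wf st) (sem_wf ss).
- exact: conj (sem_lin st) (sem_lin ss).
- move=> m; rewrite (sem_mul st) (sem_mul ss) fnd_cat domE.
  have := disj_domP d (x := (Mul, m)).
  by case: G.[? _] => [?|] /=; [move=> -> | case: D.[? _]].
- move=> e; rewrite addn_gt0 fnd_cat domE.
  have := sem_exp st (e := e); have := sem_exp ss (e := e).
  by case: D.[? _] => [?|] //= h1 h2 /orP[/h2|/h1].
- exists A, B; split=> //.
    by apply: (sem_agree st) => z C e; apply: env_cat => //; left.
  by apply: (sem_agree ss) => z C e; apply: env_cat => //; right.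
Qed.

(* The common part of the rules for cut and sub: [H] is [G,D], extended in the
   case of sub with the head variable. *)
Lemma sem_wrap (G D H : tctx) K c P Q u x t A A' B : frame K c P Q ->
  (forall z, z \in spine u -> c z = 0) ->
  sem G u A -> x \notin domf D -> sem D.[x <- A'] t B ->
  fdisjoint (domf G) (domf D.[x <- A']) ->
  (forall z, (isSome G.[? z] \/ isSome D.[? z]) -> H.[? z] = (catf G D).[? z]) ->
  wfc H -> P ->
  (forall m, c (Mul, m) + isSome G.[? (Mul, m)] = isSome H.[? (Mul, m)]) ->
  (forall e, 0 < c (Exp, e) -> isSome H.[? (Exp, e)]) ->
  Q (env_of H) A B ->
  sem H (wrap K u) B.
Proof.
move=> fK cs su xD st d HE wH p cm ce q; split=> //.
- by apply/(lin_wrap fK) => //; split=> //; exact: sem_lin su.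
- by move=> m; rewrite (cnt_wrap fK) // (sem_mul su) addnC.
- move=> e; rewrite (cnt_wrap fK) // addn_gt0 => /orP[/(sem_exp su) e1|/ce //].
  rewrite HE; last by left.
  by rewrite fnd_cat; case: ifP => //; rewrite domE.
- apply/(ty_wrap fK) => //; exists A; split=> //; apply: (sem_agree su) => z C e.
  rewrite /env_of HE; last by left; rewrite e.
  have := disj_domP d (x := z); rewrite e => /(_ isT); rewrite fnd_set.
  by case: eqP => // _ h; rewrite fnd_cat domE h e.
Qed.

(** Turns a premise typed under the binder [x] into facts about [G] alone, as every binding rule
    requires; [sem_bindI] goes back. *)
Lemma sem_bind (G : tctx) (x : var) t A B : x \notin domf G -> sem G.[x <- A] t B ->
  [/\ wfc G, kok x A, once x (cnt x t), forall m, cut_cnt x t (Mul, m) = isSome G.[? (Mul, m)]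
    & forall e, 0 < cut_cnt x t (Exp, e) -> isSome G.[? (Exp, e)]].
Proof.
move=> xG s; have [wG kx] := wfc_unset xG (sem_wf s).
have cx z : z <> x -> G.[x <- A].[? z] = G.[? z].
  by move=> /eqP zx; rewrite fnd_set (negPf zx).
split=> //.
- by rewrite /once; case: x s {xG kx cx} => k x s /= km; subst k; rewrite (sem_mul s) fnd_set eqxx.
- move=> m; rewrite /cut_cnt; case: eqP => [mx|/cx mx] /=.
    by move: xG; rewrite domE -mx; case: G.[? _].
  by rewrite (sem_mul s) mx mul1n.
- by move=> e; rewrite /cut_cnt; case: eqP => //= /cx ex; rewrite mul1n => /(sem_exp s); rewrite ex.
Qed.

Lemma typed_sem G t A : typed G t A -> sem G t A.
Proof.
elim.
- move=> m B nB; split=> //=.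
  + by apply: wfc_set => [x C|]; rewrite ?fnd_fmap0 // /kok /= (negPf nB).
  + by move=> n; rewrite fnd_set fnd_fmap0; case: eqP.
  + by rewrite env_upd /upd eqxx.
- move=> e B; split=> //=.
  + by apply: wfc_set => [x C|]; rewrite ?fnd_fmap0.
  + by move=> n; rewrite fnd_set fnd_fmap0.
  + by move=> f; rewrite fnd_set fnd_fmap0; case: eqP.
  + by rewrite env_upd /upd eqxx.
- by move=> *; apply: sem_pair.
- move=> {}G x {}t {}A B xG _ s; have [wG kx ox cm ce] := sem_bind xG s.
  split=> //=; first by split; last exact: sem_lin s.
  by exists A, B; split=> //; apply/(ty_eq _ _ (env_upd G x A))/(sem_ty s).
- move=> {}G D L v x {}t {}A B _ su xD _ st d dL; rewrite -(wrap_lplug (fun v => tCut v x t)).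
  have [wD kx ox cm ce] := sem_bind xD st.
  have d' := disj_domP d.
  have dx z : isSome G.[? z] -> D.[? z] = None.
    by move=> /d'; rewrite fnd_set; case: eqP.
  apply: (sem_wrap (cut_frame x t) _ su xD st d) => //.
  + by rewrite spine_lplug; apply: disj_cut.
  + exact: wfc_cat (sem_wf su) wD.
  + by split=> //; exact: sem_lin st.
  + move=> m; rewrite cm fnd_cat domE; have := dx (Mul, m).
    by case: D.[? _] => [?|]; case: G.[? _] => [?|] //= h; move: (h isT).
  + by move=> e /ce h; rewrite fnd_cat domE h.
  + split=> //; have := sem_ty st; apply: ty_agree => z zt; rewrite env_upd.
    have := sem_dom st zt; rewrite fnd_set /upd; case: eqP => // zx.
    by move=> h; rewrite /env_of fnd_cat domE h.
- move=> {}G m x y {}t {}A B C xG yG _ s mG.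
  (* The variable [x] is still declared when [y] is removed, so [cm'] read at a multiplicative [x]
     is the linearity of [x]. *)
  have [wG' ky oy cm' ce'] := sem_bind yG s.
  have [wG kx] := wfc_unset xG wG'.
  move: mG; rewrite domE !fnd_set; case: eqP => // my; case: eqP => // mx mG.
  have xy : x <> y by move=> xy; move: yG; rewrite domE fnd_set -xy eqxx.
  have cx z : z <> x -> G.[x <- A].[? z] = G.[? z].
    by move=> /eqP zx; rewrite fnd_set (negPf zx).
  split=> /=.
  + exact: wfc_set.
  + split=> //; last exact: sem_lin s.
    rewrite /once => xM; have xE : x = (Mul, x.2) by case: (x) xM => k n /= ->.
    by have := cm' x.2; rewrite -xE /cut_cnt fnd_set eqxx.
  + move=> n; rewrite fnd_set; have := cm' n; rewrite /cut_cnt => ->.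
    case: eqP => [->|_]; first by rewrite cx //= (negPf mG) muln0.
    case: eqP => [nx|/cx ->] //=; last by rewrite mul1n.
    by move: xG; rewrite domE -nx; case: G.[? _].
  + move=> e; rewrite fnd_set /=; case: eqP => //= /cx ex; rewrite mul1n.
    by move=> /ce'; rewrite ex.
  + exists A, B; split=> //; first by rewrite env_upd /upd eqxx.
    have := sem_ty s; apply: ty_agree => z zt; rewrite env_upd /upd.
    case: eqP => // zy; rewrite env_upd /upd; case: eqP => // zx.
    rewrite env_upd /upd; case: eqP => // zm; have := sem_dom s zt.
    by rewrite !fnd_set; do 2 (case: eqP => // _); rewrite zm (negPf mG).
- move=> {}G D L v m x {}t {}A B C _ su xD _ st d mG + dL.
  rewrite -(wrap_lplug (fun v => tSub m v x t)).
  have [wD kx ox cm ce] := sem_bind xD st.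
  rewrite !domE fnd_set in mG *; case: eqP => // mx mD.
  have d' := disj_domP d.
  have dx z : isSome G.[? z] -> D.[? z] = None.
    by move=> /d'; rewrite fnd_set; case: eqP.
  apply: (sem_wrap (sub_frame m x t) _ su xD st d) => //.
  + by rewrite spine_lplug; apply: disj_sub.
  + move=> z zGD; rewrite fnd_set; case: eqP => // zm.
    by move: zGD; rewrite zm (negPf mG) (negPf mD); case.
  + by apply: wfc_set => //; exact: wfc_cat (sem_wf su) wD.
  + by split=> //; exact: sem_lin st.
  + move=> n; rewrite /sub_cnt -/(cut_cnt x t (Mul, n)) cm fnd_set fnd_cat domE.
    case: eqP => [->|_] /=; first by rewrite (negPf mG) (negPf mD).
    have := dx (Mul, n).
    by case: D.[? _] => [?|]; case: G.[? _] => [?|] //= h; move: (h isT).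
  + by move=> e; rewrite /sub_cnt /= => /ce h; rewrite fnd_set fnd_cat domE h.
  + exists B; split=> //; first by rewrite env_upd /upd eqxx.
    have := sem_ty st; apply: ty_agree => z zt; rewrite env_upd.
    have := sem_dom st zt; rewrite fnd_set /upd; case: eqP => // zx.
    rewrite env_upd /upd; case: eqP => [->|_]; first by rewrite (negPf mD).
    by move=> h; rewrite /env_of fnd_cat domE h.
- move=> {}G e x {}t {}A B xG _ s; rewrite domE fnd_set; case: eqP => // ex eG.
  have [wG kx ox cm ce] := sem_bind xG s.
  split=> /=.
  + exact: wfc_set.
  + by split=> //; exact: sem_lin s.
  + by move=> m; rewrite fnd_set /= -cm.
  + by move=> f; rewrite fnd_set; case: eqP => //= _ /ce.
  + exists A; split=> //; first by rewrite env_upd /upd eqxx.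
    have := sem_ty s; apply: ty_agree => z zt; rewrite env_upd.
    have := sem_dom s zt; rewrite fnd_set /upd; case: eqP => // zx.
    rewrite env_upd /upd; case: eqP => [->|_] //; first by rewrite (negPf eG).
- move=> {}G {}t {}A bG _ s; split=> //=.
  + exact: sem_wf s.
  + split; last exact: sem_lin s.
    (* A multiplicative variable declared in [G] would have a type [!B] by [bG], which [sem_wf]
       excludes. *)
    move=> m; rewrite (sem_mul s); case E: G.[? _] => [B|] //.
    by have := sem_wf s E; rewrite /kok (bG _ _ E).
  + exact: sem_mul s.
  + exact: sem_exp s.
  + by exists A; split=> //; exact: sem_ty s.
- move=> {}G {}t {}A e B _ s eG; split=> //.
  + by apply: wfc_set => //; exact: sem_wf s.
  + exact: sem_lin s.
  + by move=> m; rewrite fnd_set (sem_mul s).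
  + by move=> f; rewrite fnd_set; case: eqP => // _ /(sem_exp s).
  + apply: (sem_agree s) => z C zC; rewrite env_upd /upd /env_of zC.
    by case: eqP => // ze; move: eG; rewrite domE -ze zC.
- move=> {}G {}t {}A e f B ef eG fG _ s et.
  have fe : (Exp, f) != (Exp, e) :> var by rewrite xpair_eqE /= eq_sym.
  have c z := cnt_ren f z et.
  have [w kf] : wfc G.[(Exp, e) <- fBang B] /\ kok (Exp, f) (fBang B).
    by apply: wfc_unset (sem_wf s); rewrite domE fnd_set (negPf fe) -domE.
  split=> //.
  + by apply/lin_ren => //; exact: sem_lin s.
  + by move=> m; have := c (Mul, m); rewrite /= !addn0 (sem_mul s) !fnd_set.
  + move=> g; rewrite fnd_set; case: eqP => // /eqP ge; have := c (Exp, g).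
    case: (eqVneq _ (Exp, f)) => [->|gf] /=.
      by rewrite (negPf fe); lia.
    rewrite (negPf ge) !addn0 => -> /(sem_exp s).
    by rewrite !fnd_set (negPf gf) (negPf ge).
  + apply/ty_ren => //; have := sem_ty s; apply: ty_agree => z zt.
    by rewrite !env_upd /upd eqxx.
- by move=> {}G {}t s {}A _ st /sim_alpha ts; apply: sem_sim st.
Qed.

(** * Contexts *)

(** The argument [n] is the number of occurrences of [z] in the term that fills the hole. *)
Fixpoint cntl (z : var) L n : nat :=
  match L with
  | lHole => n
  | lCut v x L => cntv z v + (z != x) * cntl z L n
  | lPar m x y L => (z == (Mul, m)) + (z != x) * ((z != y) * cntl z L n)
  | lSub m v x L => (z == (Mul, m)) + (cntv z v + (z != x) * cntl z L n)
  | lDer e x L => (z == (Exp, e)) + (z != x) * cntl z L n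
  end.

Fixpoint cntc (z : var) C : nat :=
  match C with
  | cVal V => cntcv z V
  | cCut V x s => cntcv z V + cut_cnt x s z
  | cSub m V x s => cntcv z V + sub_cnt m x s z
  | cLeft L C => cntl z L (cntc z C)
  end
with cntcv z V : nat :=
  match V with
  | vcHole => 0
  | vcPairL C s => cntc z C + cnt z s
  | vcPairR s C => cnt z s + cntc z C
  | vcLam x C => (z != x) * cntc z C
  | vcBang C => cntc z C
  end.

Lemma cntlD (z : var) L n : cntl z L n = cntl z L 0 + (z \notin lcapt L) * n.
Proof.
elim: L => /= [|v x L ->|m x y L ->|m v x L ->|e x L ->]; rewrite ?inE ?negb_or; blia.
Qed.

Lemma cnt_lplug z L t : cnt z (lplug L t) = cntl z L (cnt z t).
Proof. by elim: L => //= [v x L ->|m x y L ->|m v x L ->|e x L ->]. Qed.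

Lemma cnt_plug_plugv :
  (forall C t z, plug_ok C t -> cnt z (plug C t) = cntc z C + (z \notin capt C) * cnt z t) /\
  (forall V t z, plugv_ok V t -> cnt z (plugv V t) = cntcv z V + (z \notin captv V) * cnt z t).
Proof.
apply: ctx_vctx_ind => /=.
- by [].
- move=> V IH x s t z /andP[okV /disj_cut d].
  by rewrite (cnt_wrap (cut_frame x s) d) IH //; lia.
- move=> m V IH x s t z /andP[okV /disj_sub d].
  by rewrite (cnt_wrap (sub_frame m x s) d) IH //; lia.
- move=> L C IH t z ok; rewrite cnt_lplug IH // cntlD (cntlD z L (cntc z C)) inE negb_or.
  by case: (z \in lcapt L); case: (z \in capt C) => /=; rewrite ?mul0n ?mul1n; lia.
- by move=> t z _; rewrite mul1n.
- by move=> C IH s t z ok; rewrite IH //; lia.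
- by move=> s C IH t z ok; rewrite IH //; lia.
- by move=> x C IH t z ok; rewrite IH // !inE negb_or; blia.
- by [].
Qed.
Definition cnt_plug := cnt_plug_plugv.1.

Lemma lin_lplug L t : lin (lplug L t) -> lin t /\ forall t', lin t' ->
  (forall m, (Mul, m) \in lcapt L -> cnt (Mul, m) t' = cnt (Mul, m) t) ->
  lin (lplug L t').
Proof.
have ob (x : var) (X : {fset var}) M t' : x.1 = Mul -> x \in X ->
  (forall m, (Mul, m) \in X -> cnt (Mul, m) t' = cnt (Mul, m) t) ->
  cntl x M (cnt x t') = cntl x M (cnt x t).
  by case: x => k x /= -> xX ->.
elim: L => /= [|v x L IH|m x y L IH|m v x L IH|e x L IH]; first by [].
- move=> [lv ox /IH[lt H]]; split=> // t' lt' c; split=> //; last first.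
    by apply: H => // m mL; apply: c; rewrite !inE mL ?orbT.
  by move=> xM; move: (ox xM); rewrite !cnt_lplug (ob x _ L t' xM _ c) // !inE eqxx.
- move=> [ox oy /IH[lt H]]; split=> // t' lt' c; split=> //; last first.
  + by apply: H => // n mL; apply: c; rewrite !inE mL ?orbT.
  + by move=> xM; move: (oy xM); rewrite !cnt_lplug (ob y _ L t' xM _ c) // !inE eqxx ?orbT.
  + by move=> xM; move: (ox xM); rewrite !cnt_lplug (ob x _ L t' xM _ c) // !inE eqxx.
- move=> [lv ox /IH[lt H]]; split=> // t' lt' c; split=> //; last first.
    by apply: H => // n mL; apply: c; rewrite !inE mL ?orbT.
  by move=> xM; move: (ox xM); rewrite !cnt_lplug (ob x _ L t' xM _ c) // !inE eqxx.
- move=> [ox /IH[lt H]]; split=> // t' lt' c; split=> //; last first.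
    by apply: H => // n mL; apply: c; rewrite !inE mL ?orbT.
  by move=> xM; move: (ox xM); rewrite !cnt_lplug (ob x _ L t' xM _ c) // !inE eqxx.
Qed.

(** A new filling must keep the counts that some check above the hole looks at: those of captured
    variables, checked at their binders, and, if a box lies above, those of all multiplicative
    variables. In a multiplicative context there is no such box, which leaves a rule free to change
    the counts of uncaptured variables. *)
Lemma lin_plug_plugv :
  (forall C t, plug_ok C t -> lin (plug C t) -> lin t /\ forall t',
     plug_ok C t' -> lin t' ->
     (forall m, (Mul, m) \in capt C \/ ~~ mult_ctx C -> cnt (Mul, m) t' = cnt (Mul, m) t) ->
     lin (plug C t')) /\
  (forall V t, plugv_ok V t -> lin (plugv V t) -> lin t /\ forall t',
     plugv_ok V t' -> lin t' ->
     (forall m, (Mul, m) \in captv V \/ ~~ mult_vctx V -> cnt (Mul, m) t' = cnt (Mul, m) t) ->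
     lin (plugv V t')).
Proof.
apply: ctx_vctx_ind => /=.
- by [].
- move=> V IH x s t /andP[okV /disj_cut d] /(lin_wrap (cut_frame x s) d)[/(IH _ okV)[lt H] ls].
  split=> // t' /andP[okV' /disj_cut d'] lt' c.
  by apply/(lin_wrap (cut_frame x s) d'); split=> //; apply: H.
- move=> m V IH x s t /andP[okV /disj_sub d] /(lin_wrap (sub_frame m x s) d)[/(IH _ okV)[lt H] ls].
  split=> // t' /andP[okV' /disj_sub d'] lt' c.
  by apply/(lin_wrap (sub_frame m x s) d'); split=> //; apply: H.
- move=> L C IH t ok /lin_lplug[/(IH _ ok)[lt H] HL]; split=> // t' ok' lt' c.
  apply: HL => [|m mL].
    by apply: H => // m mC; apply: c; case: mC => mC; [left|right]; rewrite ?inE ?mC ?orbT.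
  by rewrite !cnt_plug // c // inE mL; left.
- by [].
- move=> C IH s t ok [/(IH _ ok)[lt H] ls]; split=> // t' ok' lt' c.
  by split=> //; apply: H.
- move=> s C IH t ok [ls /(IH _ ok)[lt H]]; split=> // t' ok' lt' c.
  by split=> //; apply: H.
- move=> x C IH t ok [ox /(IH _ ok)[lt H]]; split=> // t' ok' lt' c; split.
    rewrite /once; case: x ox c => k x ox c /= kM; rewrite -(ox kM) !cnt_plug //; subst k.
    by rewrite c // !inE eqxx; left.
  by apply: H => // m mC; apply: c; case: mC => mC; [left|right]; rewrite ?inE ?mC ?orbT.
- move=> C IH t ok [c0 /(IH _ ok)[lt H]]; split=> // t' ok' lt' c; split.
    by move=> m; rewrite -(c0 m) !cnt_plug // c //; right.
  by apply: H => // m _; apply: c; right.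
Qed.
Definition lin_plug := lin_plug_plugv.1.

(* Environment of the hole of a context with binders [X], when the whole term is
   moved to an environment [s]: the latter may change the cut variable, which the
   multiplicative rules consume. *)
Definition mix (X : {fset var}) (r s : env) : env := fun z => if z \in X then r z else s z.

(** The environment [r'] and the type [B] of the hole come from the typing of one filling and serve
    for every other. Since [s] is compared with [r] only on variables of [L] itself, it can drop a
    cut variable whose one occurrence is in the hole. *)
Lemma ty_lplug L r t A : ty r (lplug L t) A -> exists r' B,
  [/\ forall z, z \notin lcapt L -> r' z = r z, ty r' t B &
   forall s t', (forall z, 0 < cntl z L 0 -> s z = r z) ->
     ty (mix (lcapt L) r' s) t' B -> ty s (lplug L t') A].
Proof.
have mixE (Y : {fset var}) (x : var) A' r1 r2 s t' B :
    (forall z, z \notin Y -> r2 z = upd r1 x A' z) ->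
    ty (mix (x |` Y) r2 s) t' B -> ty (mix Y r2 (upd s x A')) t' B.
  move=> e; apply: ty_agree => z _; rewrite /mix !inE /upd.
  case: (boolP (z \in Y)) => [|zY]; rewrite ?orbT ?orbF //.
  by case: eqP => // zx; rewrite e // /upd zx eqxx.
have upE (x : var) A' (r1 s : env) (c : var -> nat) :
    (forall z, 0 < (z != x) * c z -> s z = r1 z) ->
    forall z, 0 < c z -> upd s x A' z = upd r1 x A' z.
  by move=> e z zL; rewrite /upd; case: eqP => // /eqP zx; apply: e; rewrite zx mul1n.
elim: L r => /= [|v x L IH|m x y L IH|m v x L IH|a x L IH] r.
- by move=> tt; exists r, A; split=> // s t' _; apply: ty_agree => z _; rewrite /mix !inE.
- move=> [A1 [k1 tv /IH[r' [B [e tt H]]]]]; exists r', B; split=> //.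
    by move=> z; rewrite !inE negb_or => /andP[zx /e]; rewrite /upd (negPf zx).
  move=> s t' es tt'; exists A1; split=> //.
    by apply: tyv_agree tv => z zv; rewrite es //; lia.
  apply: H; last exact: (mixE _ _ _ _ _ _ _ _ e tt').
  by apply: upE => // z zL; apply: es; lia.
- move=> [A1 [A2 [rm k1 k2 /IH[r' [B [e tt H]]]]]]; exists r', B; split=> //.
    move=> z; rewrite !inE !negb_or => /and3P[zx zy /e].
    by rewrite /upd (negPf zx) (negPf zy).
  move=> s t' es tt'; exists A1, A2; split=> //; first by rewrite es ?eqxx.
  apply: H.
    by do 2 apply: (upE); move=> z zL; apply: es; lia.
  apply: ty_agree tt' => z _; rewrite /mix !inE /upd.
  case: (boolP (z \in _)) => [|zL]; rewrite ?orbT ?orbF //.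
  by have := e z zL; rewrite /upd; case: (z =P y) => [_ ->|]; rewrite ?orbT //; case: (z =P x).
- move=> [A1 [A2 [rm k1 tv /IH[r' [B [e tt H]]]]]]; exists r', B; split=> //.
    by move=> z; rewrite !inE negb_or => /andP[zx /e]; rewrite /upd (negPf zx).
  move=> s t' es tt'; exists A1, A2; split=> //.
  + by rewrite es ?eqxx.
  + by apply: tyv_agree tv => z zv; rewrite es //; lia.
  apply: H; last exact: (mixE _ _ _ _ _ _ _ _ e tt').
  by apply: upE => // z zL; apply: es; lia.
- move=> [A1 [rm k1 /IH[r' [B [e tt H]]]]]; exists r', B; split=> //.
    by move=> z; rewrite !inE negb_or => /andP[zx /e]; rewrite /upd (negPf zx).
  move=> s t' es tt'; exists A1; split=> //; first by rewrite es ?eqxx.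
  apply: H; last exact: (mixE _ _ _ _ _ _ _ _ e tt').
  by apply: upE => // z zL; apply: es; lia.
Qed.

Lemma ty_plug_plugv :
  (forall C r t A, plug_ok C t -> ty r (plug C t) A -> exists r' B,
    [/\ forall z, z \notin capt C -> r' z = r z, ty r' t B &
     forall s t', plug_ok C t' -> (forall z, 0 < cntc z C -> s z = r z) ->
       ty (mix (capt C) r' s) t' B -> ty s (plug C t') A]) /\
  (forall V r t A, plugv_ok V t -> ty r (plugv V t) A -> exists r' B,
    [/\ forall z, z \notin captv V -> r' z = r z, ty r' t B &
     forall s t', plugv_ok V t' -> (forall z, 0 < cntcv z V -> s z = r z) ->
       ty (mix (captv V) r' s) t' B -> ty s (plugv V t') A]).
Proof.
apply: ctx_vctx_ind => /=.
- by [].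
- move=> V IH x u r t A /andP[okV /disj_cut d] /(ty_wrap (cut_frame x u) d).
  move=> [A1 [/(IH _ _ _ okV)[r' [B [e tt H]]] q]]; exists r', B; split=> //.
  move=> s t' /andP[okV' /disj_cut d'] es tt'.
  apply/(ty_wrap (cut_frame x u) d'); exists A1; split.
    by apply: H => // z zV; apply: es; lia.
  by apply: (frame_agree (cut_frame x u)) q => z zu; rewrite es //; lia.
- move=> m V IH x u r t A /andP[okV /disj_sub d] /(ty_wrap (sub_frame m x u) d).
  move=> [A1 [/(IH _ _ _ okV)[r' [B [e tt H]]] q]]; exists r', B; split=> //.
  move=> s t' /andP[okV' /disj_sub d'] es tt'.
  apply/(ty_wrap (sub_frame m x u) d'); exists A1; split.
    by apply: H => // z zV; apply: es; lia.
  by apply: (frame_agree (sub_frame m x u)) q => z zu; rewrite es //; lia.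
- move=> L C IH r t A ok /ty_lplug[r1 [B1 [e1 /(IH _ _ _ ok)[r2 [B2 [e2 tt H2]]] H1]]].
  exists r2, B2; split=> //.
    by move=> z; rewrite inE negb_or => /andP[zL zC]; rewrite e2 // e1.
  move=> s t' ok' es tt'; apply: H1.
    by move=> z zL; apply: es; rewrite cntlD; lia.
  apply: H2 => //.
    move=> z zC; rewrite /mix; case: ifPn => // zL; rewrite e1 // es //.
    by rewrite cntlD zL; lia.
  apply: ty_agree tt' => z _; rewrite /mix !inE.
  by case: (boolP (z \in capt C)) => [|/e2 ->]; rewrite ?orbT ?orbF.
- by move=> r t A _ tt; exists r, A; split=> // s t' _ _; apply: ty_agree => z _; rewrite /mix !inE.
- move=> C IH u r t A ok [A1 [A2 [-> /(IH _ _ _ ok)[r' [B [e tt H]]] tu]]].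
  exists r', B; split=> // s t' ok' es tt'; exists A1, A2; split=> //.
    by apply: H => // z zC; apply: es; lia.
  by apply: ty_agree tu => z zu; rewrite es //; lia.
- move=> u C IH r t A ok [A1 [A2 [-> tu /(IH _ _ _ ok)[r' [B [e tt H]]]]]].
  exists r', B; split=> // s t' ok' es tt'; exists A1, A2; split=> //.
    by apply: ty_agree tu => z zu; rewrite es //; lia.
  by apply: H => // z zC; apply: es; lia.
- move=> x C IH r t A ok [A1 [A2 [-> k1 /(IH _ _ _ ok)[r' [B [e tt H]]]]]].
  exists r', B; split=> //.
    by move=> z; rewrite !inE negb_or => /andP[zx /e]; rewrite /upd (negPf zx).
  move=> s t' ok' es tt'; exists A1, A2; split=> //; apply: H => //.
    move=> z zC; rewrite /upd; case: eqP => // /eqP zx; apply: es.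
    by rewrite zx mul1n.
  apply: ty_agree tt' => z _; rewrite /mix !inE.
  case: (boolP (z \in capt C)) => [|zC]; rewrite ?orbT ?orbF //.
  by have := e _ zC; rewrite /upd; case: eqP.
- move=> C IH r t A ok [A1 [-> /(IH _ _ _ ok)[r' [B [e tt H]]]]].
  by exists r', B; split=> // s t' ok' es tt'; exists A1; split=> //; apply: H.
Qed.
Definition ty_plug := ty_plug_plugv.1.

(** * Reduction *)

(** No typing context is mentioned, so the relation is closed under general contexts, which change
    the environment at the hole. Linearity of [t] is a premise because the counts rely on it: a
    copied or erased box must be free of multiplicative variables. *)
Definition pres t s := lin t -> [/\ lin s, forall m, cnt (Mul, m) s = cnt (Mul, m) t,
  forall z, 0 < cnt z s -> 0 < cnt z t & forall r A, ty r t A -> ty r s A].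

Lemma pres_plug C t s : plug_ok C t -> plug_ok C s -> pres t s ->
  pres (plug C t) (plug C s).
Proof.
move=> okt oks p /(lin_plug okt)[lt H]; have [ls cm cp tE] := p lt; split.
- by apply: H.
- by move=> m; rewrite !cnt_plug // cm.
- move=> z; rewrite !cnt_plug //; have := cp z; case: (z \in _) => /=; lia.
- move=> r A /(ty_plug okt)[r' [B [e tt Hr]]]; apply: Hr => //.
  apply/tE; apply: ty_agree tt => z _; rewrite /mix; case: ifPn => // /e ->//.
Qed.

(** Common core of the multiplicative rules that act inside a context: the hole trades its
    occurrence of [m] for the variables of [v]. The cut binds one occurrence of [m] and [t] contains
    it, so [M] has none and can be retyped without [m]; [r1] and [r2] are the environments of the
    hole before and after. *)
Lemma pres_cut_mul v (m : nat) M t t' :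
  plug_ok M t -> plug_ok M t' -> mult_ctx M ->
  (Mul, m) \notin capt M -> (forall z, z \in capt M -> cntv z v = 0) ->
  0 < cnt (Mul, m) t ->
  (forall z, cnt z t' + (z == (Mul, m)) = cnt z t + cntv z v) ->
  (lin t -> linv v -> lin t') ->
  (forall (r1 r2 : env) B, cnt (Mul, m) t = 1 -> tyv r2 v (r1 (Mul, m)) ->
    (forall z, z != (Mul, m) -> r1 z = r2 z) -> ty r1 t B -> ty r2 t' B) ->
  pres (tCut v (Mul, m) (plug M t)) (plug M t').
Proof.
move=> okt okt' multM mM dv cm0 ct lt' tyt' [lv /(_ erefl) cm lp].
have [lt H] := lin_plug okt lp.
have cM z : z \in capt M -> cnt z t' = cnt z t.
  move=> zM; have := ct z; rewrite dv //; case: eqP => [zm|_]; last lia.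
  by move: mM; rewrite -zm zM.
have [cmM cmt] : cntc (Mul, m) M = 0 /\ cnt (Mul, m) t = 1.
  by move: cm; rewrite cnt_plug // mM; lia.
have cE z : cnt z (plug M t') = cnt z (tCut v (Mul, m) (plug M t)).
  rewrite /= !cnt_plug //; have := ct z; have := cM z; have := dv z.
  case: (boolP (z \in capt M)) => /= zM.
    move=> /(_ isT) -> _ _; case: eqP => [zm|_]; last lia.
    by move: mM; rewrite -zm zM.
  by move=> _ _; case: eqP => [->|_]; rewrite ?cmM ?cmt; lia.
split=> [|n|z|r A /= [T [_ tv /(ty_plug okt)[r' [B [e tt Hr]]]]]]; rewrite ?cE //.
  apply: H => //; first exact: lt'.
  by rewrite multM => n [/cM|].
apply: Hr => //.
  by move=> z zM; rewrite /upd; case: eqP => // zm; move: zM; rewrite zm cmM.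
have eT : r' (Mul, m) = T by rewrite e // /upd eqxx.
apply: tyt' tt => //; last first.
  by move=> z zm; rewrite /mix; case: ifPn => // /e ->; rewrite /upd (negPf zm).
rewrite eT; apply: tyv_agree tv => z zv; rewrite /mix; case: ifP => // zM.
by move: zv; rewrite dv.
Qed.

(** Common core of the exponential rules that keep their cut. The context may cross boxes, so the
    multiplicative counts of the hole must not change at all. The copied material lands in the scope
    of [e], where it keeps its type because [e] is not free in [v]. *)
Lemma pres_cut_exp v (e : nat) C t t' :
  plug_ok C t -> plug_ok C t' ->
  (Exp, e) \notin capt C -> cntv (Exp, e) v = 0 -> (forall z, z \in capt C -> cntv z v = 0) ->
  (linv v -> forall m, cnt (Mul, m) t' = cnt (Mul, m) t) ->
  (forall z, 0 < cnt z t' -> 0 < cnt z t \/ 0 < cntv z v) ->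
  (lin t -> linv v -> lin t') ->
  (forall (r : env) B, tyv r v (r (Exp, e)) -> ty r t B -> ty r t' B) ->
  pres (tCut v (Exp, e) (plug C t)) (tCut v (Exp, e) (plug C t')).
Proof.
move=> okt okt' eC ev dv cm cp lt' tyt' [lv _ lp].
have [lt H] := lin_plug okt lp; split=> [|m|z|r A] /=.
- split=> //; apply: H => //; first exact: lt'.
  by move=> m _; apply: cm.
- by rewrite !cnt_plug // cm.
- by rewrite !cnt_plug //; have := cp z; case: (z \in _); case: (z == _) => /=; lia.
move=> [T [kT tv /(ty_plug okt)[r' [B [er tt Hr]]]]]; exists T; split=> //.
apply: Hr => //; apply: tyt'.
  have -> : mix (capt C) r' (upd r (Exp, e) T) (Exp, e) = T.
    by rewrite /mix (negPf eC) /upd eqxx.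
  apply: tyv_agree tv => z zv; rewrite /mix; case: ifPn => [zC|_].
    by move: zv; rewrite dv.
  by rewrite /upd; case: eqP => // ze; move: zv; rewrite ze ev.
by apply: ty_agree tt => z _; rewrite /mix; case: ifPn => // /er ->.
Qed.

Lemma fdisj0 (X Y : {fset var}) (f : var -> nat) : fdisjoint X Y ->
  (forall z, (z \in Y) = (0 < f z)) -> forall z, z \in X -> f z = 0.
Proof. by move=> /fdisjointP d e z /d; rewrite e; lia. Qed.

Lemma pres_tensor (m : nat) M s u (x y : var) t :
  let u' := wrap (fun v' => tCut v' y t) u in
  let t' := wrap (fun v => tCut v x u') s in
  plug_ok M (tPar m x y t) -> plug_ok M t' -> mult_ctx M ->
  (Mul, m) \notin capt M -> fdisjoint (capt M) (fv s `|` fv u) ->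
  x \notin fv u ->
  fdisjoint (spine s) (fv u `|` (fv t `\ y `\ x)) ->
  fdisjoint (spine u) (fv t `\ y) ->
  pres (tCut (vPair s u) (Mul, m) (plug M (tPar m x y t))) (plug M t').
Proof.
move=> u' t' okt okt' multM mM dM xu ds /disj_cut du.
have {}xu : cnt x u = 0 by move: xu; rewrite mem_fv; lia.
have cu z : cnt z u' = cnt z u + cut_cnt y t z by rewrite (cnt_wrap (cut_frame y t)).
have {}ds z : z \in spine s -> cut_cnt x u' z = 0.
  move=> zs; move/fdisjointP: ds => /(_ _ zs); rewrite !inE !mem_fv /cut_cnt cu /cut_cnt.
  by case: eqP => //= _; case: eqP => //= _; lia.
have ct z : cnt z t' = cnt z s + (cnt z u + (z != x) * ((z != y) * cnt z t)).
  rewrite (cnt_wrap (cut_frame x u')) // /cut_cnt cu /cut_cnt.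
  by case: (z =P x) => [->|_]; rewrite ?xu; lia.
apply: pres_cut_mul => //.
- by apply: fdisj0 dM _ => z; rewrite inE !mem_fv /= ; lia.
- by rewrite /= eqxx.
- by move=> z; rewrite ct /=; lia.
- move=> /= [ox oy lt] [ls lu]; apply/(lin_wrap (cut_frame x u')) => //; split=> //.
  split; first by rewrite cu xu.
  by apply/(lin_wrap (cut_frame y t)).
move=> r1 r2 B /=; rewrite eqxx => mt [A1 [A2 [rm ts tu]]] er [B1 [B2 [rm' k1 k2 tt]]].
(* The type of [m] is read at the pair and at the par; injectivity of [fTensor] identifies the
   components. *)
move: rm'; rewrite rm => -[??]; subst B1 B2.
apply/(ty_wrap (cut_frame x u')) => //; exists A1; split=> //; split=> //.
apply/(ty_wrap (cut_frame y t)) => //; exists A2; split.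
  by apply: ty_agree tu => z zu; rewrite /upd; case: eqP => // zx; move: zu; rewrite zx xu.
split=> //; apply: ty_agree tt => z zt; rewrite /upd; case: eqP => // /eqP zy.
case: eqP => // /eqP zx; apply: er; apply/eqP => zm; move: mt.
by rewrite -zm zx zy; lia.
Qed.

Lemma pres_lolli (m : nat) M s v (x y : var) t :
  let t' := tCut v y (wrap (fun v' => tCut v' x t) s) in
  plug_ok M (tSub m v x t) -> plug_ok M t' -> mult_ctx M ->
  (Mul, m) \notin capt M -> fdisjoint (capt M) (fvv (vLam y s)) ->
  y \notin fv t `\ x -> fdisjoint (spine s) (fv t `\ x) ->
  pres (tCut (vLam y s) (Mul, m) (plug M (tSub m v x t))) (plug M t').
Proof.
move=> t' okt okt' multM mM dM yt /disj_cut ds.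
have {}yt : (y != x) * cnt y t = 0 by move: yt; rewrite !inE mem_fv; case: eqP => //=; lia.
have cs z : cnt z (wrap (fun v' => tCut v' x t) s) = cnt z s + (z != x) * cnt z t.
  exact: (cnt_wrap (cut_frame x t)).
apply: pres_cut_mul => //.
- by apply: fdisj0 dM _ => z; rewrite mem_fvv.
- by rewrite /= eqxx.
- move=> z; rewrite /= cs; case: (z =P y) => [->|_]; last lia.
  by rewrite yt; lia.
- move=> /= [lv ox lt] [oy ls]; split=> //; first by rewrite cs yt addn0.
  by apply/(lin_wrap (cut_frame x t)).
move=> r1 r2 B /=; rewrite eqxx => mt [A1 [A2 [rm ky ts]]] er [B1 [B2 [rm' kx tv tt]]].
move: rm'; rewrite rm => -[??]; subst B1 B2.
exists A1; split=> //.
  apply: tyv_agree tv => z zv; apply: er; apply/eqP => zm; move: mt zv; rewrite zm; lia.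
apply/(ty_wrap (cut_frame x t)) => //; exists A2; split=> //; split=> //.
apply: ty_agree tt => z zt; rewrite /upd; case: eqP => // /eqP zx.
case: eqP => zy; first by subst z; move: yt; rewrite zx; lia.
by apply: er; apply/eqP => zm; move: mt; rewrite -zm zx; lia.
Qed.

Lemma pres_bang_der (e : nat) C s (x : var) t :
  let t' := wrap (fun v => tCut v x t) s in
  plug_ok C (tDer e x t) -> plug_ok C t' ->
  (Exp, e) \notin fv s -> (Exp, e) \notin capt C -> fdisjoint (capt C) (fv s) ->
  fdisjoint (spine s) (fv t `\ x) ->
  pres (tCut (vBang s) (Exp, e) (plug C (tDer e x t)))
       (tCut (vBang s) (Exp, e) (plug C t')).
Proof.
move=> t' okt okt' es eC dC /disj_cut ds.
have ct z : cnt z t' = cnt z s + (z != x) * cnt z t.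
  exact: (cnt_wrap (cut_frame x t)).
apply: pres_cut_exp => //.
- by move: es; rewrite mem_fv /=; lia.
- by apply: fdisj0 dC _ => z; rewrite mem_fv.
- by move=> [ms _] m; rewrite ct ms.
- by move=> z; rewrite ct /=; lia.
- by move=> [ox lt] [_ ls]; apply/(lin_wrap (cut_frame x t)).
move=> r B [A [rA ts]] [A' [rA' kx tt]].
move: rA'; rewrite rA => -[?]; subst A'.
by apply/(ty_wrap (cut_frame x t)) => //; exists A; split.
Qed.

Lemma exp_value_mul v m : exp_value v -> linv v -> cntv (Mul, m) v = 0.
Proof. by case: v => //= t _ []. Qed.

Lemma root_pres t s : root t s -> pres t s.
Proof.
case.
- move=> v m M w w' mv multM mM dM [okt <-] [okt' <-].
  apply: pres_cut_mul => //.
  + by apply: fdisj0 dM _ => z; rewrite mem_fvv.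
  + by rewrite /= eqxx.
  + by move=> z /=; rewrite addnC.
  + by move=> r1 r2 B _ tv _ /= <-.
- move=> n m {}t nt [_ /(_ erefl) cm lt].
  have c z := cnt_ren m z nt.
  (* Since [m] occurs once, the renaming trades one [m] for one [n], the occurrence contributed by
     the cut value. *)
  have cE z : cnt z (ren Mul n m t) = (z == (Mul, n)) + (z != (Mul, m)) * cnt z t.
    by have := c z; rewrite cm; case: eqP => [->|_] /=; rewrite ?cm; lia.
  split=> [|k|z|r A [T [_ <- tt]]]; rewrite ?cE //; first exact/lin_ren.
  exact/ty_ren.
- move=> L v L' v' m M x y {}t w w' /= multM mM dM xu dL dL' [okt <-].
  rewrite !cut_lplug.
  move=> [okt' <-]; apply: pres_tensor => //; by rewrite spine_lplug.
- move=> L v v' y m M x {}t w w' /= multM mM dM yt dL [okt <-].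
  rewrite cut_lplug.
  by move=> [okt' <-]; apply: pres_lolli => //; rewrite spine_lplug.
- move=> v e C w w' xv ev eC dC [okt <-] [okt' <-].
  apply: pres_cut_exp => //=.
  + by move: ev; rewrite mem_fvv; lia.
  + by apply: fdisj0 dC _ => z; rewrite mem_fvv.
  + by move=> lv m; rewrite exp_value_mul.
  + by move=> z; right.
  + by move=> r B tv <-.
- move=> f e C x {}t w w' fe eC fC [okt <-] [okt' <-].
  apply: pres_cut_exp => //=.
  + by rewrite xpair_eqE /= eq_sym (negPf fe).
  + by move=> z zC; case: eqP => // zf; move: fC; rewrite -zf zC.
  + by move=> z; lia.
  + by move=> r B -> [A []]; exists A.
- move=> L v e C x {}t w w' /= es eC dC dL [okt <-].
  rewrite cut_lplug => -[okt' <-].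
  by apply: pres_bang_der => //; rewrite spine_lplug.
- move=> v e {}t xv et [lv _ lt].
  have {}et : cnt (Exp, e) t = 0 by move: et; rewrite mem_fv; lia.
  split=> [//|m|z|r A [T [_ _ tt]]] /=.
  + by rewrite exp_value_mul // mul1n.
  + by case: eqP => [->|_] /=; rewrite ?et; lia.
  + apply: ty_agree tt => z zt; rewrite /upd; case: eqP => // ze.
    by move: zt; rewrite ze et.
Qed.

Lemma pres_sim t t' s' s : sim t t' -> pres t' s' -> sim s' s -> pres t s.
Proof.
move=> [c1 l1 t1 _] p [c2 l2 t2 _] /l1 /p[ls cm cp tE]; split; first exact/l2.
- by move=> m; rewrite -c2 cm c1.
- by move=> z; rewrite -c2 c1; apply: cp.
- by move=> r A /t1 /tE /t2.
Qed.

Lemma step_pres t s : step_ms t s -> pres t s.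
Proof.
move=> [C [t0 [s0 [t' [s' [[t1 [s1 [/sim_alpha a1 /root_pres p /sim_alpha a2]]]
  [okt <-] [oks <-] /sim_alpha a3 /sim_alpha a4]]]]]].
by apply: pres_sim a3 _ a4; apply: pres_plug => //; apply: pres_sim a1 p a2.
Qed.

Lemma sem_pres G t s A : pres t s -> sem G t A -> sem G s A.
Proof.
move=> p [w lt cm ce tt]; have [ls cms cp tE] := p lt; split=> //.
- by move=> m; rewrite cms.
- by move=> e /cp /ce.
- exact: tE.
Qed.

(** * Freshening, weakening and contraction *)

Lemma fresh_var (X : {fset var}) (k : kind) : exists j : nat, (k, j) \notin X.
Proof.
exists (\max_(x <- X) x.2).+1; apply/negP => jX.
by have := @leq_bigmax_seq var (enum_fset X) xpredT (fun x => x.2) _ jX isT; rewrite /= ltnn.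
Qed.

Lemma freshen_freshenv (X : {fset var}) :
  (forall t, exists t', alpha t t' /\ fdisjoint X (bv t')) /\
  (forall v, exists v', alphav v v' /\ fdisjoint X (bvv v')).
Proof.
have fr (Y : {fset var}) (k : kind) t : exists j : nat,
    [/\ unused (k, j) t, (k, j) \notin X & (k, j) \notin Y].
  have [j] := fresh_var (fv t `|` bv t `|` X `|` Y) k.
  rewrite !inE !negb_or => /andP[/andP[/andP[a b] c] d]; exists j; split=> //.
  by rewrite /unused inE negb_or a.
apply: term_value_ind => /=.
- by move=> v [v' [a d]]; exists (tVal v'); split=> //; apply: al_val.
- move=> v [v' [av dv]] [k i] t [t' [a d]]; have [j [ju jX _]] := fr fset0 k t'.
  exists (tCut v' (k, j) (ren k j i t')); split.
    exact: al_trans (al_cut _ av a) (al_cut_ren _ _ ju).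
  by rewrite /= !fdisjointXU fdisjointX1 bv_ren dv jX d.
- move=> m [k1 i1] [k2 i2] t [t' [a d]].
  (* The inner binder is renamed first, away from the outer one; the outer binder then avoids the
     new inner name. These are the side conditions of [al_par_ren2] and [al_par_ren1]. *)
  have [j [ju jX]] := fr [fset (k1, i1)] k2 t'; rewrite inE => jx.
  have [l [lu lX]] := fr [fset (k2, j)] k1 (ren k2 j i2 t'); rewrite inE => ly.
  exists (tPar m (k1, l) (k2, j) (if (k1, i1) == (k2, j) then ren k2 j i2 t'
                                  else ren k1 l i1 (ren k2 j i2 t'))); split.
    apply: al_trans (al_par m (k1, i1) (k2, i2) a) _.
    exact: al_trans (al_par_ren2 m i2 ju jx) (al_par_ren1 m i1 lu ly).
  by rewrite eq_sym (negPf jx) /= !fdisjointXU !fdisjointX1 !bv_ren jX lX d.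
- move=> m v [v' [av dv]] [k i] t [t' [a d]]; have [j [ju jX _]] := fr fset0 k t'.
  exists (tSub m v' (k, j) (ren k j i t')); split.
    exact: al_trans (al_sub m _ av a) (al_sub_ren m _ _ ju).
  by rewrite /= !fdisjointXU fdisjointX1 bv_ren dv jX d.
- move=> e [k i] t [t' [a d]]; have [j [ju jX _]] := fr fset0 k t'.
  exists (tDer e (k, j) (ren k j i t')); split.
    exact: al_trans (al_der e _ a) (al_der_ren e _ ju).
  by rewrite /= !fdisjointXU fdisjointX1 bv_ren jX d.
- by move=> m; exists (vMul m); split; [apply: alv_refl | apply: fdisjointX0].
- by move=> m; exists (vExp m); split; [apply: alv_refl | apply: fdisjointX0].
- move=> t [t' [a d]] s [s' [a' d']]; exists (vPair t' s'); split; first exact: alv_pair.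
  by rewrite /= fdisjointXU d d'.
- move=> [k i] t [t' [a d]]; have [j [ju jX _]] := fr fset0 k t'.
  exists (vLam (k, j) (ren k j i t')); split.
    exact: alv_trans (alv_lam _ a) (alv_lam_ren _ ju).
  by rewrite /= !fdisjointXU fdisjointX1 bv_ren jX d.
- by move=> t [t' [a d]]; exists (vBang t'); split=> //; apply: alv_bang.
Qed.
Definition freshen X := (freshen_freshenv X).1.

Lemma kok_exp e A : kok (Exp, e) A -> exists B, A = fBang B.
Proof. by case: A => // B; exists B. Qed.

(** The list [l] covers the variables where [H] may differ from [G]. They are added one at a time by
    [ty_weak], and [wfc H] makes their types of the form [!B]. *)
Lemma typed_weaken (l : seq var) G H t A : typed G t A -> wfc H ->
  (forall x, x \in l -> x.1 = Exp) ->
  (forall x, x \notin l -> H.[? x] = G.[? x]) ->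
  (forall x, isSome G.[? x] -> H.[? x] = G.[? x]) -> typed H t A.
Proof.
elim: l G => [|x l IH] G tt wH lE e1 e2.
  by have -> // : H = G by apply/fmapP => x; apply: e1.
have lE' y : y \in l -> y.1 = Exp by move=> yl; apply: lE; rewrite inE yl orbT.
have [e|[C [Gx Hx]]] : H.[? x] = G.[? x] \/ exists C, G.[? x] = None /\ H.[? x] = Some C.
- case Gx: G.[? x] => [C|]; first by left; rewrite e2 ?Gx.
  by case: H.[? x] => [C|]; [right; exists C | left].
- apply: (IH G) => // y yl; case: (eqVneq y x) => [->|yx] //.
  by apply: e1; rewrite inE (negPf yx).
have xE : x = (Exp, x.2) by have := lE x (mem_head _ _); case: (x) => k n /= ->.
have [B CB] : exists B, C = fBang B by apply: (kok_exp (e := x.2)); rewrite -xE; exact: wH Hx.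
apply: (IH G.[x <- C]) => //.
- by rewrite xE CB; apply: ty_weak; rewrite // -xE domE Gx.
- move=> y yl; rewrite fnd_set; case: (eqVneq y x) => [->|yx] //.
  by apply: e1; rewrite inE (negPf yx).
- move=> y; rewrite fnd_set; case: (eqVneq y x) => [->|yx] //; exact: e2.
Qed.

Lemma rem_set (G : tctx) (x : var) E : G.[? x] = Some E -> G.[~ x].[x <- E] = G.
Proof.
move=> e; apply/fmapP => y; rewrite fnd_set; case: eqP => [->|yx]; first by rewrite e.
by rewrite fnd_rem1; case: eqP.
Qed.

Lemma dom_rem (G : tctx) (x : var) : x \notin domf G.[~ x].
Proof. by rewrite domE fnd_rem1 eqxx. Qed.

(** Contraction read from conclusion to premise; [sem_unren] supplies the matching step for
    [sem]. *)
Lemma typed_unren (G : tctx) (e f : nat) t A E :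
  wfc G -> G.[? (Exp, e)] = Some E -> (Exp, f) \notin domf G -> (Exp, e) \notin bv t ->
  typed G.[(Exp, f) <- E] t A -> typed G (ren Exp e f t) A.
Proof.
move=> wG Ge fG et; have [B eB] := kok_exp (wG _ _ Ge).
have ef : e != f by apply/eqP => ef; move: fG; rewrite domE -ef Ge.
have [G0 [eG0 GE]] : exists G0 : tctx, (Exp, e) \notin domf G0 /\ G = G0.[(Exp, e) <- E].
  by exists G.[~ (Exp, e)]; rewrite dom_rem rem_set.
subst G => tt; rewrite eB in fG tt *; apply: ty_contr => //.
by move: fG; rewrite !domE fnd_set xpair_eqE /= eq_sym (negPf ef).
Qed.

Lemma sem_unren (G : tctx) (e f : nat) t A E :
  G.[? (Exp, e)] = Some E -> (Exp, f) \notin domf G -> (Exp, e) \notin bv t ->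
  sem G (ren Exp e f t) A -> sem G.[(Exp, f) <- E] t A.
Proof.
move=> Ge fG et [w lt cm ce tt]; have c z := cnt_ren f z et; split.
- by apply: wfc_set => //; exact: w Ge.
- exact/(lin_ren f et).
- by move=> m; rewrite fnd_set /= -cm; have := c (Mul, m); rewrite /= !addn0.
- move=> g cg; rewrite fnd_set; case: eqP => // /eqP gf; apply: ce.
  by have := c (Exp, g); rewrite (negPf gf); lia.
- move/(ty_ren _ _ _ et): tt; apply: ty_agree => z _; rewrite env_upd /upd.
  by rewrite {1}/env_of Ge.
Qed.

Lemma ren_id_renv_id k j i :
  (forall t, cnt (k, i) t = 0 -> ren k j i t = t) /\
  (forall v, cntv (k, i) v = 0 -> renv k j i v = v).
Proof.
have hd k' m : (k, i) == (k', m) = 0 :> nat -> renn k j i k' m = m.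
  by rewrite /renn xpair_eqE !(eq_sym k') (eq_sym m); case: ifP.
have bd (x : var) t : (cnt (k, i) t = 0 -> ren k j i t = t) -> ((k, i) != x) * cnt (k, i) t = 0 ->
    (if x == (k, i) then t else ren k j i t) = t.
  by rewrite eq_sym; case: eqP => //= _ IH; rewrite mul1n.
apply: term_value_ind => /=.
- by move=> v IH /IH ->.
- by move=> v IHv x t /bd IH /eqP; rewrite addn_eq0 => /andP[/eqP/IHv -> /eqP/IH ->].
- move=> m x y t IH /eqP; rewrite addn_eq0 => /andP[/eqP/hd -> /eqP e]; congr tPar.
  move: e; rewrite (eq_sym x) (eq_sym y).
  by case: eqP => //= _; case: eqP => //= _; rewrite !mul1n.
- move=> m v IHv x t /bd IH /eqP; rewrite !addn_eq0.
  by move=> /and3P[/eqP/hd -> /eqP/IHv -> /eqP/IH ->].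
- by move=> m x t /bd IH /eqP; rewrite addn_eq0 => /andP[/eqP/hd -> /eqP/IH ->].
- by move=> m /hd ->.
- by move=> m /hd ->.
- by move=> t IHt s IHs /eqP; rewrite addn_eq0 => /andP[/eqP/IHt -> /eqP/IHs ->].
- by move=> x t /bd IH /IH ->.
- by move=> t IH /IH ->.
Qed.
Definition ren_id k j i := (ren_id_renv_id k j i).1.

Lemma renK_renvK k j i :
  (forall t, cnt (k, j) t = 0 -> (k, j) \notin bv t -> ren k i j (ren k j i t) = t) /\
  (forall v, cntv (k, j) v = 0 -> (k, j) \notin bvv v -> renv k i j (renv k j i v) = v).
Proof.
have hd k' m : (k, j) == (k', m) = 0 :> nat -> renn k i j k' (renn k j i k' m) = m.
  rewrite /renn xpair_eqE !(eq_sym k') !(eq_sym _ m); case: eqP => //= _.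
  by case: (eqVneq m i) => [->|mi]; [rewrite eqxx | case: ifP].
have bd (x : var) t : (cnt (k, j) t = 0 -> (k, j) \notin bv t -> ren k i j (ren k j i t) = t) ->
    ((k, j) != x) * cnt (k, j) t = 0 -> (k, j) != x -> (k, j) \notin bv t ->
    (if x == (k, j) then if x == (k, i) then t else ren k j i t
     else ren k i j (if x == (k, i) then t else ren k j i t)) = t.
  move=> IH c jx jt; rewrite eq_sym (negPf jx); move: c; rewrite jx mul1n => c.
  by case: ifP => _; [apply: (ren_id_renv_id _ _ _).1 | apply: IH].
apply: term_value_ind => /=.
- by move=> v IH c b; rewrite IH.
- move=> v IHv x t /bd IH /eqP; rewrite addn_eq0 !inE !negb_or => /andP[/eqP/IHv hv /eqP/IH ht].
  by move=> /and3P[/hv -> jx jt]; rewrite ht.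
- move=> m x y t IH /eqP; rewrite addn_eq0 !inE !negb_or => /andP[/eqP/hd -> /eqP e].
  move=> /and3P[jx jy jt]; congr tPar; move: e; rewrite jx jy !mul1n => e.
  rewrite !(eq_sym _ (k, j)) (negPf jx) (negPf jy) /=.
  by case: ifP => _; [apply: (ren_id_renv_id _ _ _).1 | apply: IH].
- move=> m v IHv x t /bd IH /eqP; rewrite !addn_eq0 !inE !negb_or.
  by move=> /and3P[/eqP/hd -> /eqP/IHv hv /eqP/IH ht] /and3P[/hv -> jx jt]; rewrite ht.
- move=> m x t /bd IH /eqP; rewrite !addn_eq0 !inE !negb_or.
  by move=> /andP[/eqP/hd -> /eqP/IH ht] /andP[jx jt]; rewrite ht.
- by move=> m /hd ->.
- by move=> m /hd ->.
- move=> t IHt s IHs /eqP; rewrite addn_eq0 !inE negb_or => /andP[/eqP/IHt ht /eqP/IHs hs].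
  by move=> /andP[/ht -> /hs ->].
- by move=> x t /bd IH /IH ht; rewrite !inE negb_or => /andP[jx jt]; rewrite ht.
- by move=> t IH c b; rewrite IH.
Qed.

(** * From the syntax-directed judgement to typing *)

(* The outermost constructor of a term splits it into two parts that may share
   exponential variables; [lpart] and [rpart] count the occurrences in them. *)
Definition lpart (z : var) t : nat :=
  match t with
  | tVal (vPair l _) => cnt z l
  | tCut v _ _ | tSub _ v _ _ => cntv z v
  | tDer e _ _ => z == (Exp, e)
  | _ => 0
  end.

Definition rpart (z : var) t : nat :=
  match t with
  | tVal (vPair _ r) => cnt z r
  | tCut _ x t | tSub _ _ x t | tDer _ x t => cut_cnt x t z
  | _ => 0
  end.

(** In [tDer] the left part is the head variable: the typing rule wants it fresh for the body, so a
    head that recurs there has to be contracted too. The head of [tSub] is multiplicative and cannot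
    be shared. *)
Definition lren f e t :=
  match t with
  | tVal (vPair l r) => tVal (vPair (ren Exp f e l) r)
  | tCut v x t => tCut (renv Exp f e v) x t
  | tSub m v x t => tSub m (renv Exp f e v) x t
  | tDer d x t => tDer (renn Exp f e Exp d) x t
  | _ => t
  end.

Lemma bv_lren f e t : bv (lren f e t) = bv t.
Proof.
by case: t => [[]|||| ] //= *; rewrite ?bv_ren ?(bv_ren_renv _ _ _).2.
Qed.

Lemma sz_lren f e t : sz (lren f e t) = sz t.
Proof.
by case: t => [[]|||| ] //= *; rewrite ?sz_ren ?(sz_ren_renv _ _ _).2.
Qed.

Lemma rpart_lren f e t z : rpart z (lren f e t) = rpart z t.
Proof. by case: t => [[]|||| ]. Qed.

(** The progress made by one renaming: [e] has left the left part, and [f] is the only newcomer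
    there. *)
Lemma lpart_lren (f e : nat) t z : (Exp, f) \notin bv t -> f != e ->
  0 < lpart z (lren f e t) -> z != (Exp, e) /\ (z = (Exp, f) \/ 0 < lpart z t).
Proof.
move=> ft fe.
have fe' : (Exp, e) == (Exp, f) :> var = false by rewrite xpair_eqE /= eq_sym (negPf fe).
have aux (n n' c : nat) : n' + (z == (Exp, e)) * c = n + (z == (Exp, f)) * c ->
    (z = (Exp, e) -> n = c) -> 0 < n' -> z != (Exp, e) /\ (z = (Exp, f) \/ 0 < n).
  case: (z =P (Exp, f)) => [->|zf]; first by rewrite eq_sym fe' => _ _ _; split=> //; left.
  by case: (z =P (Exp, e)) => [->|ze] /= h1 h2 h3; [have := h2 erefl; lia | split=> //; right; lia].
case: t ft => [[m|m|l r|x t|t]|v x t|m x y t|m v x t|d x t] //=.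
- rewrite inE negb_or => /andP[fl _].
  by apply: aux (cnt_ren e z fl) _ => ->.
- rewrite !inE !negb_or => /and3P[fv _ _].
  by apply: aux ((cnt_ren_renv Exp f e).2 v z fv) _ => ->.
- rewrite !inE !negb_or => /and3P[fv _ _].
  by apply: aux ((cnt_ren_renv Exp f e).2 v z fv) _ => ->.
- move=> _; apply: (aux _ _ ((Exp, e) == (Exp, d) :> var)); last by move=> ->.
  by apply: ((cnt_ren_renv Exp f e).2 (vExp d) z); rewrite inE.
Qed.

(** As [f] is fresh for [t], renaming it back throughout the term affects only the left part; this
    exhibits [t] as the conclusion of a contraction. *)
Lemma lrenK (f e : nat) t : cnt (Exp, f) t = 0 -> (Exp, f) \notin bv t ->
  ren Exp e f (lren f e t) = t.
Proof.
have rv v : cntv (Exp, f) v = 0 -> (Exp, f) \notin bvv v ->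
  renv Exp e f (renv Exp f e v) = v by exact: (renK_renvK _ _ _).2.
have bd (x : var) t0 : ((Exp, f) != x) * cnt (Exp, f) t0 = 0 ->
    (if x == (Exp, f) then t0 else ren Exp e f t0) = t0.
  by rewrite eq_sym; case: eqP => //= _; rewrite mul1n; apply: ren_id.
case: t => [[m|m|l r|x t|t]|v x t|m x y t|m v x t|d x t];
  try by move=> c _; rewrite [lren _ _ _]/= ren_id.
- move=> /= /eqP; rewrite addn_eq0 inE negb_or => /andP[/eqP cl /eqP cr] /andP[bl br].
  by rewrite (renK_renvK _ _ _).1 // ren_id.
- move=> /= /eqP; rewrite addn_eq0 !inE !negb_or => /andP[/eqP cl /eqP cr] /and3P[bl bx br].
  by rewrite rv // bd.
- move=> /= /eqP; rewrite !addn_eq0 !inE !negb_or => /and3P[_ /eqP cl /eqP cr] /and3P[bl bx br].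
  by rewrite rv // bd.
- move=> /= /eqP; rewrite addn_eq0 !inE !negb_or => /andP[/eqP cl /eqP cr] _.
  by have := rv (vExp d) cl; rewrite inE => /(_ isT)[->]; rewrite bd.
Qed.

(** * Splitting a typing context along free variables *)

Lemma sem_restrict (G : tctx) t A : wfc G -> lin t -> ty (env_of G) t A ->
  (forall z, 0 < cnt z t -> isSome G.[? z]) -> (forall m, cnt (Mul, m) t <= 1) ->
  sem G.[& fv t] t A.
Proof.
move=> w lt tt ct cm; split=> //.
- by move=> x B; rewrite fnd_restrict; case: ifP => // _ /w.
- move=> m; rewrite fnd_restrict mem_fv; have := ct (Mul, m); have := cm m.
  by case: (cnt _ _) => [|[|]] //= _ -> .
- by move=> e ce; rewrite fnd_restrict mem_fv ce ct.
- apply: ty_agree tt => z zt; rewrite /env_of fnd_restrict mem_fv zt //.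
Qed.

Lemma sem_bindI (G : tctx) (x : var) t A B : x \notin domf G -> wfc G -> kok x A ->
  once x (cnt x t) -> lin t ->
  (forall m, cut_cnt x t (Mul, m) = isSome G.[? (Mul, m)]) ->
  (forall e, 0 < cut_cnt x t (Exp, e) -> isSome G.[? (Exp, e)]) ->
  ty (upd (env_of G) x A) t B -> sem G.[x <- A] t B.
Proof.
move=> xG wG kx ox lt cm ce tt; split=> //.
- exact: wfc_set.
- move=> m; rewrite fnd_set; have := cm m; rewrite /cut_cnt.
  by case: eqP => [mx|_] /=; [move=> _; rewrite mx ox // -mx | rewrite mul1n].
- move=> e; rewrite fnd_set; have := ce e; rewrite /cut_cnt.
  by case: eqP => //= _; rewrite mul1n.
- by apply: ty_agree tt => z _; rewrite env_upd.
Qed.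

Lemma cat_restrict (G : tctx) (X : {fset var}) : catf G.[& X] G.[\ X] = G.
Proof.
apply/fmapP => z; rewrite fnd_cat domE fnd_rem fnd_restrict.
by case: (z \in X) => //; case: G.[? z].
Qed.

Lemma disj_restrict (G : tctx) (X : {fset var}) : fdisjoint (domf G.[& X]) (domf G.[\ X]).
Proof.
by apply/fdisjointP => z; rewrite !domE fnd_rem fnd_restrict; case: (z \in X).
Qed.

Lemma wfc_rem (G : tctx) (X : {fset var}) : wfc G -> wfc G.[\ X].
Proof. by move=> w x A; rewrite fnd_rem; case: ifP => // _ /w. Qed.

Lemma env_some (G : tctx) x A : isSome G.[? x] -> env_of G x = A -> G.[? x] = Some A.
Proof. by rewrite /env_of; case: G.[? x] => //= B _ ->. Qed.

(** Splitting sends the declarations that occur nowhere down to the leaves. There all declarations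
    other than that of [z0] are exponential, and this is where the return to [typed] weakens. *)
Lemma typed_leaf (G : tctx) t A (z0 : var) : wfc G -> isSome G.[? z0] ->
  (forall z, isSome G.[? z] -> z = z0 \/ z.1 = Exp) ->
  (forall B, G.[? z0] = Some B -> typed [fmap].[z0 <- B] t A) -> typed G t A.
Proof.
case E: G.[? z0] => [B|] // w _ gz tt.
apply: (@typed_weaken (filter (fun z => z != z0) (domf G)) _ _ _ _ (tt _ erefl)) => // z.
- rewrite mem_filter => /andP[/eqP zz]; rewrite -[_ \in _]/(z \in domf G) domE.
  by case/gz.
- rewrite mem_filter negb_and negbK fnd_set fnd_fmap0.
  case: eqP => [->|] //= _; rewrite -[_ \notin _]/(z \notin domf G) domE.
  by case: G.[? z].
- by rewrite fnd_set fnd_fmap0; case: eqP => [->|].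
Qed.

(** The left part receives exactly its free variables and the right part all the rest. The right
    part loses nothing it uses: exponential variables are not shared by assumption, multiplicative
    ones because they occur at most once. *)
Lemma sem_pair_split (G : tctx) l r A B : sem G (tVal (vPair l r)) (fTensor A B) ->
  (forall e, 0 < cnt (Exp, e) l -> cnt (Exp, e) r = 0) ->
  sem G.[& fv l] l A /\ sem G.[\ fv l] r B.
Proof.
move=> s ns; have [w /= [ll lr] cm ce [A' [B' [[<- <-] tl tr]]]] := s; split.
  apply: sem_restrict => // [z zl|m]; first by apply: sem_dom s _ => /=; lia.
  by have := cm m; case: (isSome _) => /=; lia.
split=> //.
- exact: wfc_rem.
- move=> m; have := cm m; rewrite fnd_rem mem_fv.
  by case: ltnP => /= cl; case: G.[? _] => [?|] /=; lia.
- move=> e er; have el : cnt (Exp, e) l = 0 by have := ns e; lia.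
  by rewrite fnd_rem mem_fv el /=; apply: ce; lia.
- apply: ty_agree tr => z zr; rewrite /env_of fnd_rem mem_fv; case: ifP => // zl.
  case: z zr zl => -[] n zr zl; last by rewrite ns in zr.
  by have := cm n; case: G.[? _] => [?|] /=; lia.
Qed.

Lemma sem_bind_split (G : tctx) l (x : var) t A A' B : wfc G -> lin l ->
  kok x A' -> once x (cnt x t) -> lin t -> x \notin domf G ->
  (forall m, cnt (Mul, m) l + cut_cnt x t (Mul, m) = isSome G.[? (Mul, m)]) ->
  (forall e, 0 < cnt (Exp, e) l + cut_cnt x t (Exp, e) -> isSome G.[? (Exp, e)]) ->
  (forall e, 0 < cnt (Exp, e) l -> cut_cnt x t (Exp, e) = 0) ->
  ty (env_of G) l A -> ty (upd (env_of G) x A') t B ->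
  sem G.[& fv l] l A /\ sem G.[\ fv l].[x <- A'] t B.
Proof.
move=> w ll kx ox lt xG cm ce ns tl tt.
have cl m : cnt (Mul, m) l <= 1 by have := cm m; case: G.[? _] => [?|] /=; lia.
split.
  apply: sem_restrict => // -[[] n] zl; last by apply: ce; lia.
  by have := cm n; case: G.[? _] => [?|] //=; lia.
apply: sem_bindI => //.
- by move: xG; rewrite !domE fnd_rem; case: ifP.
- exact: wfc_rem.
- move=> m; have := cm m; rewrite fnd_rem mem_fv.
  by case: ltnP => /= lm; case: G.[? _] => [?|] /=; lia.
- move=> e er; have el : cnt (Exp, e) l = 0 by have := ns e; lia.
  by rewrite fnd_rem mem_fv el /=; apply: ce; lia.
apply: ty_agree tt => z zt; rewrite /upd; case: eqP => // /eqP zx.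
rewrite /env_of fnd_rem mem_fv; case: ifP => // zl.
have cz : cut_cnt x t z = cnt z t by rewrite /cut_cnt zx mul1n.
case: z zx zt zl cz => -[] n zx zt zl cz; last by move: zt; rewrite -cz ns.
by have := cm n; rewrite cz; case: G.[? _] => [?|] /=; lia.
Qed.

Lemma remE (G : tctx) (x y : var) : x <> y -> G.[~ x].[? y] = G.[? y].
Proof. by move=> xy; rewrite fnd_rem1; case: eqP => // yx; case: xy. Qed.

Definition complete n := forall t G A, sz t < n -> sem G t A -> typed G t A.

(** Without sharing, each constructor comes from its own typing rule, cut and sub with the empty
    left context; the parts are smaller, so [complete n] applies. Disjointness from [bv t] provides
    the freshness premises at binders. *)
Lemma typed_unshared n t (G : tctx) A : complete n -> sz t <= n ->
  fdisjoint (domf G) (bv t) -> (forall e, 0 < lpart (Exp, e) t -> rpart (Exp, e) t = 0) ->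
  sem G t A -> typed G t A.
Proof.
move=> IH szt + ns s; have w := sem_wf s.
have xb (x : var) b : fdisjoint (domf G) b -> x \in b -> x \notin domf G.
  by move=> /fdisjointP d xb; apply/negP => /d; rewrite xb.
case: t szt ns s => [[m|e|l r|x t|t]|v x t|m x y t|m v x t|e x t].
- move=> _ _ s _; have [_ _ cm ce] := s; rewrite /= => tm.
  have Gm : isSome G.[? (Mul, m)] by apply: (sem_dom s); rewrite /= eqxx.
  apply: (typed_leaf (z0 := (Mul, m))) => // [[[] n'] zG|B e]; [left|by right|].
    by have := cm n'; rewrite zG /=; case: eqP.
  have -> : A = B by move: tm; rewrite /env_of e.
  by apply: ty_mvar; have := w _ _ e; rewrite /kok /=; case: is_bang.
- move=> _ _ s _; have [_ _ cm ce] := s; rewrite /= => te.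
  have Ge : isSome G.[? (Exp, e)] by apply: (sem_dom s); rewrite /= eqxx.
  apply: (typed_leaf (z0 := (Exp, e))) => // [[[] n'] zG|B eB]; [|by right|].
    by have := cm n'; rewrite zG.
  have -> : A = B by move: te; rewrite /env_of eB.
  by have [C ->] := kok_exp (w _ _ eB); apply: ty_evar.
- move=> /= szt ns s _; case: (s) => _ _ _ _ /= [A1 [A2 [AE _ _]]]; subst A.
  have [sl sr] := sem_pair_split s ns.
  rewrite -(cat_restrict G (fv l)); apply: ty_pair (disj_restrict _ _).
    by apply: IH sl; lia.
  by apply: IH sr; lia.
- move=> /= szt _ s /xb xG; have {}xG : x \notin domf G by apply: xG; rewrite !inE eqxx.
  have [_ /= [ox lt] cm ce [A1 [A2 [-> kx tt]]]] := s.
  apply: ty_lam => //; apply: IH; first lia.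
  by apply: sem_bindI.
- move=> /= szt _ s _; have [_ /= [c0 lt] cm ce [B [-> tt]]] := s.
  apply: ty_bang.
    move=> [[] n'] C zC; last by have := w _ _ zC; rewrite /kok /= => /eqP <-.
    by have := cm n'; rewrite c0 zC.
  by apply: IH; [lia | split].
- move=> /= szt ns s /xb xG; have {}xG : x \notin domf G by apply: xG; rewrite !inE eqxx orbT.
  have [_ /= [lv ox lt] cm ce [A1 [kx tv tt]]] := s.
  have [sv st] := sem_bind_split (l := tVal v) w lv kx ox lt xG cm ce ns tv tt.
  rewrite -(cat_restrict G (fvv v)); apply: (ty_cut (L := lHole)).
  + by apply: IH sv => /=; lia.
  + by move: xG; rewrite !domE fnd_rem; case: ifP.
  + by apply: IH st; lia.
  + rewrite dom_setf fdisjointXU fdisjointX1 disj_restrict andbT.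
    by move: xG; rewrite !domE fnd_restrict; case: ifP.
  + exact: fdisjoint0X.
- move=> /= szt _ s /xb xyG.
  have xG : x \notin domf G by apply: xyG; rewrite !inE eqxx.
  have yG : y \notin domf G by apply: xyG; rewrite !inE eqxx orbT.
  (* The syntax lets [y] shadow [x], whereas [ty_par] wants distinct binders; in the case of
     shadowing [x] gets a fresh name. *)
  have [x' [xy xG' a]] : exists x' : var,
      [/\ x' != y, x' \notin domf G & alpha (tPar m x y t) (tPar m x' y t)].
    case: (eqVneq x y) => [xy|xy]; last by exists x; split=> //; apply: al_refl.
    case: x xy {xG xyG s} => k i xy.
    have [j] := fresh_var (fv t `|` bv t `|` domf G `|` [fset y]) k.
    rewrite !in_fsetU in_fset1 !negb_or => /andP[/andP[/andP[jf jb] jG] jy].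
    exists (k, j); split=> //.
    by have := al_par_ren1 m i _ jy; rewrite xy eqxx; apply; rewrite /unused in_fsetU negb_or jf.
  apply: ty_alpha (al_sym a); move/(sem_sim (sim_alpha a)): s => s.
  move: x' xy xG' s {xG xyG a} => {}x xy xG s.
  have [_ /= [ox oy lt] cm ce [A1 [A2 [rm kx ky tt]]]] := s.
  have Gm : G.[? (Mul, m)] = Some (fTensor A1 A2).
    by apply: env_some rm; apply: (sem_dom s); rewrite /= eqxx.
  have mx : (Mul, m) <> x by move=> mx; move: xG; rewrite domE -mx Gm.
  have my : (Mul, m) <> y by move=> my; move: yG; rewrite domE -my Gm.
  rewrite -(rem_set Gm); apply: (ty_par (x := x) (y := y) (A := A1) (B := A2)).
  + by rewrite domE remE // -domE.
  + by rewrite domE fnd_set eq_sym (negPf xy) remE // -domE.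
  + apply: IH; first lia.
    split=> //.
    * by do 2 apply: wfc_set => //; apply: wfc_rem.
    * move=> k; rewrite !fnd_set fnd_rem1; have := cm k.
      case: ((Mul, k) =P y) => [ny|_] /=; first by rewrite ny oy // -ny.
      case: ((Mul, k) =P x) => [nx|_] /=.
        by move=> _; have := ox; rewrite -nx nx xy mul1n => -> //; rewrite -nx.
      by rewrite !mul1n; case: ((Mul, k) =P (Mul, m)) => [->|_] //=; rewrite Gm /=; lia.
    * move=> e; rewrite !fnd_set fnd_rem1; have := ce e.
      by do 2 (case: eqP => //= _); rewrite !mul1n.
    apply: ty_agree tt => z zt; rewrite !env_upd /upd; case: eqP => // /eqP zy.
    rewrite env_upd /upd; case: eqP => // /eqP zx; rewrite /env_of remE // => zm.
    by have := cm m; rewrite Gm eqxx zm zx zy /=; lia.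
  + rewrite domE !fnd_set; case: eqP => // _; case: eqP => // _.
    by rewrite -domE dom_rem.
- move=> /= szt ns s /xb xG; have {}xG : x \notin domf G by apply: xG; rewrite !inE eqxx orbT.
  have [_ /= [lv ox lt] cm ce [A1 [A2 [rm kx tv tt]]]] := s.
  have Gm : G.[? (Mul, m)] = Some (fLolli A1 A2).
    by apply: env_some rm; apply: (sem_dom s); rewrite /= eqxx.
  have mx : (Mul, m) <> x by move=> mx; move: xG; rewrite domE -mx Gm.
  set H := G.[~ (Mul, m)]; have HG z : z <> (Mul, m) -> H.[? z] = G.[? z].
    by move=> zm; apply: remE => mz; apply: zm.
  have Hm : H.[? (Mul, m)] = None by rewrite /H fnd_rem1 eqxx.
  have wH : wfc H by apply: wfc_rem.
  have xH : x \notin domf H by rewrite domE HG -?domE // => xm; apply: mx.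
  (* The head already is the one occurrence of [m] that the context allows, hence neither argument
     contains it. *)
  have cmm : cntv (Mul, m) v + cut_cnt x t (Mul, m) = 0.
    by have := cm m; rewrite Gm eqxx /cut_cnt /=; lia.
  have cH k : cntv (Mul, k) v + cut_cnt x t (Mul, k) = isSome H.[? (Mul, k)].
    case: (eqVneq k m) => [->|nm]; first by rewrite Hm.
    rewrite HG => [|[/eqP]]; last by rewrite (negPf nm).
    by rewrite -cm xpair_eqE /= (negPf nm).
  have eH e : 0 < cntv (Exp, e) v + cut_cnt x t (Exp, e) -> isSome H.[? (Exp, e)].
    by rewrite HG // => /ce.
  have [sv st] : sem H.[& fvv v] (tVal v) A1 /\ sem H.[\ fvv v].[x <- A2] t A.
    apply: (sem_bind_split (l := tVal v) wH lv kx ox lt xH cH eH ns).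
      apply: tyv_agree tv => z zv; rewrite /env_of HG // => zm.
      by move: zv cmm; rewrite zm /=; lia.
    apply: ty_agree tt => z zt; rewrite /upd; case: eqP => // /eqP zx.
    rewrite /env_of HG // => zm.
    by move: cmm; rewrite -zm /cut_cnt zx; lia.
  rewrite -(rem_set Gm) -/H -(cat_restrict H (fvv v)); apply: (ty_sub (L := lHole)).
  + by apply: IH sv => /=; lia.
  + by move: xH; rewrite !domE fnd_rem; case: ifP.
  + by apply: IH st; lia.
  + rewrite dom_setf fdisjointXU fdisjointX1 disj_restrict andbT.
    by move: xH; rewrite !domE fnd_restrict; case: ifP.
  + by rewrite domE fnd_restrict Hm; case: ifP.
  + by rewrite domE fnd_set fnd_rem Hm; case: eqP => //; case: ifP.
  + exact: fdisjoint0X.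
- move=> /= szt ns s /xb xG; have {}xG : x \notin domf G by apply: xG; rewrite !inE eqxx.
  have [_ /= [ox lt] cm ce [A1 [re kx tt]]] := s.
  have Ge : G.[? (Exp, e)] = Some (fBang A1).
    by apply: env_some re; apply: (sem_dom s); rewrite /= eqxx.
  have ex : (Exp, e) <> x by move=> ex; move: xG; rewrite domE -ex Ge.
  have et : cut_cnt x t (Exp, e) = 0 by apply: ns; rewrite eqxx.
  have HG z : z <> (Exp, e) -> G.[~ (Exp, e)].[? z] = G.[? z].
    by move=> zm; apply: remE => mz; apply: zm.
  have xH : x \notin domf G.[~ (Exp, e)] by rewrite domE HG -?domE // => xe; apply: ex.
  rewrite -(rem_set Ge); apply: (ty_der xH).
    apply: IH; first lia.
    apply: sem_bindI => //.
    + exact: wfc_rem.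
    + by move=> k; rewrite HG // -cm.
    + move=> f ft; rewrite HG; first by apply: ce; rewrite -/(cut_cnt x t (Exp, f)); lia.
      by move=> fe; move: ft; rewrite fe et.
    apply: ty_agree tt => z zt; rewrite /upd; case: eqP => // /eqP zx.
    rewrite /env_of HG // => ze.
    by move: et; rewrite -ze /cut_cnt zx; lia.
  by rewrite domE fnd_set; case: eqP => // _; rewrite -domE dom_rem.
Qed.

(** Induction on a list [l] bounding the shared variables. The renamed term has the same size as
    [t], so [complete n] is held back until nothing is shared, and then applied to the parts. *)
Lemma typed_share n t (G : tctx) A (l : seq nat) : complete n -> sz t <= n ->
  fdisjoint (domf G) (bv t) ->
  (forall e, 0 < lpart (Exp, e) t -> 0 < rpart (Exp, e) t -> e \in l) ->
  sem G t A -> typed G t A.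
Proof.
move=> IH; elim: l t G => [|e l IHl] t G szt d sh s.
  apply: (typed_unshared IH szt d) s => e le; apply/eqP; rewrite -leqn0 leqNgt.
  by apply/negP => /(sh e le).
case: (boolP ((0 < lpart (Exp, e) t) && (0 < rpart (Exp, e) t))) => [/andP[le re]|ne]; last first.
  apply: IHl s => // g lg rg; have := sh g lg rg; rewrite inE => /orP[/eqP ge|//].
  by move: ne; rewrite -ge lg rg.
have ce : 0 < cnt (Exp, e) t.
  by case: (t) le => [[]|||| ] //= *; rewrite ?addn_gt0; lia.
have := sem_dom s ce; case Ge: G.[? _] => [E|] // _.
have [f] := fresh_var (fv t `|` bv t `|` domf G) Exp.
rewrite !in_fsetU !negb_or mem_fv => /andP[/andP[ft fb] fG].
have {}ft : cnt (Exp, f) t = 0 by lia.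
have fe : f != e by apply/eqP => fe; move: ft; rewrite fe; lia.
have eb : (Exp, e) \notin bv (lren f e t).
  by rewrite bv_lren; move/fdisjointP: d; apply; rewrite domE Ge.
rewrite -(lrenK e ft fb); apply: (typed_unren (sem_wf s) Ge fG eb).
apply: IHl.
- by rewrite sz_lren.
- by rewrite bv_lren dom_setf fdisjointUX fdisjoint1X fb d.
- move=> g; rewrite rpart_lren => /(lpart_lren fb fe)[ge [[gf]|lg]] rg.
    have := rg; rewrite gf => rf; suff : 0 < cnt (Exp, f) t by rewrite ft.
    by case: (t) rf => [[]|||| ] //=; rewrite /cut_cnt; lia.
  by have := sh g lg rg; rewrite inE => /orP[/eqP gE|//]; move: ge; rewrite gE eqxx.
by apply: (sem_unren Ge fG eb); rewrite lrenK.
Qed.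

Lemma completeness n : complete n.
Proof.
elim: n => [|n IH] t G A szt s; first by [].
have [t' [a d]] := freshen (domf G) t.
have sa := sim_alpha a; apply: ty_alpha (al_sym a).
have szt' : sz t' <= n by case: sa => _ _ _ <-.
(* The names of all free variables, of either kind, bound the shared ones. *)
apply: (typed_share (l := undup [seq x.2 | x <- fv t']) IH szt' d) (sem_sim sa s) => e le _.
rewrite mem_undup; apply/mapP; exists (Exp, e) => //; rewrite -[_ \in _]/(_ \in fv t') mem_fv.
by case: (t') le => [[]|||| ] //= *; lia.
Qed.

Theorem theorem7p4 (G : tctx) (t s : term) (A : formula)
  (typed_t : typed G t A) (red_ts : step_ms t s) : typed G s A.
Proof.
apply: (completeness (n := (sz s).+1)) => //.
exact: sem_pres (step_pres red_ts) (typed_sem typed_t).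
Qed.
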